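(* Let $p>2$ be an integer, let $k$ be a field of characteristic $0$ containing a primitive $p$-th root of unity $\omega$, and let $T_p$ be the Taft algebra over $k$. Then: (1) the Gerstenhaber bracket on the Hochschild cohomology $\mathrm{HH}^*(T_p)=\bigoplus_{n\ge 0}\operatorname{Ext}^n_{T_p\otimes T_p^{op}}(T_p,T_p)$ is not identically zero; (2) the Gerstenhaber bracket on the Hopf algebra cohomology $\mathrm{H}^*(T_p,k)=\bigoplus_{n\ge 0}\operatorname{Ext}^n_{T_p}(k,k)$ is identically zero, i.e. $[\alpha,\beta]=0$ for all homogeneous $\alpha,\beta\in \mathrm{H}^*(T_p,k)$.
   Context: All tensor products are over $k$ unless indicated. The Taft algebra $T_p$ is the $k$-algebra generated by $g,x$ with relations $g^p=1$, $x^p=0$, $xg=\omega gx$. It is a Hopf algebra with $\Delta(g)=g\otimes g$, $\Delta(x)=1\otimes x+x\otimes g$, $\varepsilon(g)=1$, $\varepsilon(x)=0$, $S(g)=g^{-1}$, $S(x)=-xg^{-1}$; its antipode is bijective since it is finite dimensional. Gerstenhaber bracket on Hochschild cohomology: for a $k$-algebra $A$, $\mathrm{HH}^*(A)$ is computed by the bar resolution with cochains $\operatorname{Hom}_{A\otimes A^{op}}(A^{\otimes(n+2)},A)\cong\operatorname{Hom}_k(A^{\otimes n},A)$. For $f\in\operatorname{Hom}_k(A^{\otimes m},A)$ and $h\in\operatorname{Hom}_k(A^{\otimes n},A)$ put $$(f\circ h)(a_1\otimes\cdots\otimes a_{m+n-1})=\sum_{i=1}^m(-1)^{(n-1)(i-1)}f(a_1\otimes\cdots\otimes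 a_{i-1}\otimes h(a_i\otimes\cdots\otimes a_{i+n-1})\otimes a_{i+n}\otimes\cdots\otimes a_{m+n-1}),$$ $[f,h]=f\circ h-(-1)^{(m-1)(n-1)}h\circ f$; this induces the Gerstenhaber bracket on $\mathrm{HH}^*(A)$. Gerstenhaber bracket on Hopf algebra cohomology: let $A$ be a Hopf algebra with bijective antipode $S$, counit $\varepsilon$ and unit map $\eta$. Let $A^{ad}$ be $A$ with the left adjoint action $a\cdot b=\sum a_1bS(a_2)$. Regard $A^e=A\otimes A^{op}$ as a right $A$-module via the algebra map $A\to A^e$, $a\mapsto\sum a_1\otimes S(a_2)$. Then $A\cong A^e\otimes_Ak$ as $A^e$-modules, via $a\mapsto (a\otimes 1)\otimes_A 1$, and the Eckmann–Shapiro isomorphism gives $\mathrm{HH}^*(A)\cong\operatorname{Ext}^*_A(k,A^{ad})=:\mathrm{H}^*(A,A^{ad})$; the Gerstenhaber bracket is transported to $\mathrm{H}^*(A,A^{ad})$ along this isomorphism. The $A$-module maps $\eta:k\to A^{ad}$ and $\varepsilon:A^{ad}\to k$ induce an embedding $\eta_*:\mathrm{H}^*(A,k)\to\mathrm{H}^*(A,A^{ad})$ and a map $\varepsilon_*:\mathrm{H}^*(A,A^{ad})\to\mathrm{H}^*(A,k)$. The bracket on $\mathrm{H}^*(A,k)$ is $[\alpha,\beta]=\varepsilon_*[\eta_*(\alpha),\eta_*(\beta)]$. *)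

(* Defs.v *)
From mathcomp Require Import all_boot all_order all_algebra.

Set Implicit Arguments.
Unset Strict Implicit.
Unset Printing Implicit Defensive.

Import GRing.Theory.
Local Open Scope ring_scope.

(* A pure tensor a_1 (x) ... (x) a_n of A^{(x) n} is written as the word      *)
(* [:: a_1; ...; a_n], and Hom_k(A^{(x) n}, M) is the set of maps on words    *)
(* that are n-linear on words of size n.  Such a map carries no information   *)
(* on words of other sizes: cochains of degree n are always compared on words *)
(* of size n only.                                                            *)
Definition multilinear (k : fieldType) (A M : lmodType k) (n : nat)
    (f : seq A -> M) : Prop :=
  forall s t : seq A, (size s + size t).+1 = n ->
    linear (fun a : A => f (s ++ a :: t)).

(* A list of words of size n stands for the sum of the corresponding pure     *)
(* tensors; two lists give the same element of A^{(x) n} iff no n-linear map  *)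
(* separates them (universal property of the tensor product).                 *)
Definition tensor_eq (k : fieldType) (A : lmodType k) (n : nat)
    (s t : seq (seq A)) : Prop :=
  forall (M : lmodType k) (f : seq A -> M), multilinear n f ->
    \sum_(w <- s) f w = \sum_(w <- t) f w.

Definition word2 (A : Type) (u : A * A) : seq A := [:: u.1; u.2].

Definition tensor2_eq (k : fieldType) (A : lmodType k) (s t : seq (A * A)) :
    Prop :=
  tensor_eq 2 [seq word2 u | u <- s] [seq word2 u | u <- t].

(* delta a lists the terms (a_1, a_2) of Sweedler's sum for Delta(a); it is   *)
(* only meaningful, and only constrained, up to equality in A (x) A.          *)
Record is_hopf (k : fieldType) (A : algType k) (delta : A -> seq (A * A))
    (eps : {lrmorphism A -> k^o}) (S : {linear A -> A}) : Prop := IsHopf {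
  hopf_delta_linear : forall (c : k) (a b : A),
    tensor2_eq (delta (c *: a + b))
               ([seq (c *: u.1, u.2) | u <- delta a] ++ delta b);
  hopf_delta1 : tensor2_eq (delta 1) [:: (1, 1)];
  hopf_deltaM : forall a b : A,
    tensor2_eq (delta (a * b))
               [seq (u.1 * v.1, u.2 * v.2) | u <- delta a, v <- delta b];
  hopf_coassoc : forall a : A,
    tensor_eq 3 [seq [:: v.1; v.2; u.2] | u <- delta a, v <- delta u.1]
                [seq [:: u.1; v.1; v.2] | u <- delta a, v <- delta u.2];
  hopf_counitl : forall a : A,
    \sum_(u <- delta a) (eps u.1 : k) *: u.2 = a;
  hopf_counitr : forall a : A,
    \sum_(u <- delta a) (eps u.2 : k) *: u.1 = a;
  hopf_antipodel : forall a : A,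
    \sum_(u <- delta a) S u.1 * u.2 = (eps a : k)%:A;
  hopf_antipoder : forall a : A,
    \sum_(u <- delta a) u.1 * S u.2 = (eps a : k)%:A
}.

Definition taft_relations (k : fieldType) (p : nat) (omega : k)
    (B : algType k) (g x : B) : Prop :=
  [/\ g ^+ p = 1, x ^+ p = 0 & x * g = omega *: (g * x)].

(* T is the algebra presented by the generators g, x and the Taft relations.  *)
Definition is_taft_algebra (k : fieldType) (p : nat) (omega : k)
    (T : algType k) (g x : T) : Prop :=
  taft_relations p omega g x /\
  forall (B : algType k) (g' x' : B), taft_relations p omega g' x' ->
    exists phi : {lrmorphism T -> B},
      [/\ phi g = g', phi x = x' &
          forall psi : {lrmorphism T -> B},
            psi g = g' -> psi x = x' -> psi =1 phi].

(* g^-1 is written g ^+ p.-1, which is the inverse of g since g ^+ p = 1.     *)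
Definition is_taft_hopf (k : fieldType) (p : nat) (T : algType k) (g x : T)
    (delta : T -> seq (T * T)) (eps : {lrmorphism T -> k^o})
    (S : {linear T -> T}) : Prop :=
  [/\ is_hopf delta eps S,
      tensor2_eq (delta g) [:: (g, g)] /\
        tensor2_eq (delta x) [:: (1, x); (x, g)],
      eps g = 1 /\ eps x = 0 &
      S g = g ^+ p.-1 /\ S x = - (x * g ^+ p.-1)].

Section BarComplex.
Variables (k : fieldType) (A : algType k) (M : lmodType k).
Variables (lact : A -> M -> M) (ract : M -> A -> M).

(* The differential C^n -> C^{n+1} of Hom_{A^e}(Bar(A), M) for the bimodule M *)
(* with actions lact and ract:                                                *)
(*   (d f)(a_1,...,a_{n+1}) = a_1 f(a_2,...,a_{n+1})                          *)
(*      + \sum_{1 <= i <= n} (-1)^i f(..., a_i a_{i+1}, ...)                  *)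
(*      + (-1)^{n+1} f(a_1,...,a_n) a_{n+1}.                                  *)
(* Below, i is counted from 0 and a_{i+1} is w`_i.                            *)
Definition bar_diff (n : nat) (f : seq A -> M) (w : seq A) : M :=
  lact w`_0 (f (behead w))
  + \sum_(i < n)
      (-1) ^+ i.+1 *: f (take i w ++ (w`_i * w`_i.+1) :: drop i.+2 w)
  + (-1) ^+ n.+1 *: ract (f (take n w)) w`_n.

Definition cocycle (n : nat) (f : seq A -> M) : Prop :=
  multilinear n f /\ forall w, size w = n.+1 -> bar_diff n f w = 0.

Definition coboundary (n : nat) (f : seq A -> M) : Prop :=
  if n is n'.+1 then
    exists2 h : seq A -> M, multilinear n' h &
      forall w, size w = n -> f w = bar_diff n' h w
  else f [::] = 0.

Definition cohomologous (n : nat) (f h : seq A -> M) : Prop :=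
  coboundary n (fun w => f w - h w).
End BarComplex.

Section HochschildCohomology.
Variables (k : fieldType) (A : algType k).
Implicit Types f h : seq A -> A.

Definition HH_cocycle (n : nat) f : Prop :=
  cocycle (fun a b : A => a * b) (fun b a : A => b * a) n f.

Definition HH_coboundary (n : nat) f : Prop :=
  coboundary (fun a b : A => a * b) (fun b a : A => b * a) n f.

(* With i counted from 0, the sign (-1)^{(n-1)(i-1)} is (-1)^{(n-1) i}; it is *)
(* written with n + 1 instead of n - 1, which has the same parity and is also *)
(* correct for n = 0, where subtraction on nat would truncate.                *)
Definition circ (m n : nat) f h (w : seq A) : A :=
  \sum_(i < m) (-1) ^+ (n.+1 * i) *:
     f (take i w ++ h (take n (drop i w)) :: drop (i + n) w).

(* For m = n = 0 both sums are empty, so the bracket, of degree -1, is 0.     *)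
Definition gbracket (m n : nat) f h (w : seq A) : A :=
  circ m n f h w - (-1) ^+ (m.+1 * n.+1) *: circ n m h f w.
End HochschildCohomology.

Section HopfCohomology.
Variables (k : fieldType) (A : algType k) (delta : A -> seq (A * A)).
Variables (eps : {lrmorphism A -> k^o}) (S : {linear A -> A}).

(* Ext_A(k, M) is computed by the bar resolution P_n = A (x) A^{(x) n} of the *)
(* left A-module k: Hom_A(P_n, M) = Hom_k(A^{(x) n}, M), and the differential *)
(* is the one above for M with right action through eps.                      *)
Section Coefficients.
Variables (M : lmodType k) (act : A -> M -> M).

Definition ext_cocycle (n : nat) (f : seq A -> M) : Prop :=
  cocycle act (fun m a => (eps a : k) *: m) n f.

Definition ext_coboundary (n : nat) (f : seq A -> M) : Prop :=
  coboundary act (fun m a => (eps a : k) *: m) n f.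

Definition ext_cohomologous (n : nat) (f h : seq A -> M) : Prop :=
  cohomologous act (fun m a => (eps a : k) *: m) n f h.
End Coefficients.

Definition triv_act (a : A) (c : k^o) : k^o := eps a * c.

Definition ad_act (a b : A) : A := \sum_(u <- delta a) u.1 * b * S u.2.

(* For w = a_1 (x) ... (x) a_n, the terms (a_11 (x) ... (x) a_n1,             *)
(* a_12 ... a_n2), where a_i1 (x) a_i2 runs over Delta(a_i).                  *)
Fixpoint sweedler (w : seq A) : seq (seq A * A) :=
  if w is a :: w' then
    [seq (u.1 :: v.1, u.2 * v.2) | u <- delta a, v <- sweedler w']
  else [:: ([::], 1)].

(* The Eckmann-Shapiro isomorphism HH^n(A) -> H^n(A, A^ad) on bar cochains.   *)
(* Restricting Hom_{A^e}(A^e (x)_A P_n, A) = Hom_A(P_n, A^ad) along an        *)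
(* A^e-linear comparison A^e (x)_A P -> Bar(A) over A^e (x)_A k = A means     *)
(* precomposing with an A-linear chain map theta : P -> Bar(A) lifting        *)
(* k -> A, 1 |-> 1, where a acts on Bar(A) by b |-> \sum a_1 b S(a_2).        *)
(* Such a map is unique up to homotopy, and one is                            *)
(*   theta(1 (x) a_1 (x) ... (x) a_n)                                         *)
(*     = \sum 1 (x) a_11 (x) ... (x) a_n1 (x) S(a_12 ... a_n2).               *)
(* Here f in Hom_k(A^{(x) n}, A) is evaluated through its A^e-linear          *)
(* extension b_0 (x) ... (x) b_{n+1} |-> b_0 f(b_1, ..., b_n) b_{n+1}.        *)
Definition eckmann_shapiro (f : seq A -> A) (w : seq A) : A :=
  \sum_(v <- sweedler w) 1 * f v.1 * S v.2.

Definition eta_star (alpha : seq A -> k^o) (w : seq A) : A :=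
  (alpha w : k)%:A.

Definition eps_star (phi : seq A -> A) (w : seq A) : k^o := eps (phi w).

(* The Hochschild class of f corresponds to the class of phi in H^n(A, A^ad). *)
Definition es_lift (n : nat) (phi f : seq A -> A) : Prop :=
  HH_cocycle n f /\ ext_cohomologous ad_act n (eckmann_shapiro f) phi.

(* gamma represents [alpha, beta] = eps_*[eta_* alpha, eta_* beta] in         *)
(* H^{m+n-1}(A, k).  Degree -1 only occurs for m = n = 0; it is then replaced *)
(* by degree 0, in which gbracket 0 0 is the zero cochain.                    *)
Definition is_hopf_bracket (m n : nat) (alpha beta gamma : seq A -> k^o) :
    Prop :=
  exists f h : seq A -> A,
    [/\ es_lift m (eta_star alpha) f, es_lift n (eta_star beta) h &
        ext_cohomologous triv_act (m + n).-1 gamma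
          (eps_star (eckmann_shapiro (gbracket m n f h)))].
End HopfCohomology.

(* Main.v *)
Require Import Defs.
From HB Require Import structures.
From mathcomp Require Import all_boot all_order all_algebra.
From mathcomp Require Import zify.

Set Implicit Arguments.
Unset Strict Implicit.
Unset Printing Implicit Defensive.

Import GRing.Theory.
Local Open Scope ring_scope.

(* (1) Let D be the derivation of T_p with D(g) = 0 and D(x) = x, and let xi  *)
(* be the 2-cocycle of the infinitesimal deformation x^p = t.  As xi lowers   *)
(* the degree in x by p, [D, xi] = - p xi.  This is not a coboundary: on      *)
(* (x, x^(p-1)) a coboundary x u(x^(p-1)) - u(0) + u(x) x^(p-1) is killed by  *)
(* eps, while xi takes the value 1.                                           *)
(*                                                                            *)
(* (2) H^n(T_p, k) = 0 for n odd.  Indeed there is an exact sequence of       *)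
(* T_p-modules 0 -> k -> I_0 -> I_1 -> k -> 0 in which I_0 and I_1 are        *)
(* coinduced from characters of the semisimple algebra k<g>, hence acyclic,   *)
(* so that H^(n+2)(T_p, k) embeds into H^n(T_p, k) for n > 0; and H^1 = 0.    *)
(* Now let alpha and beta have degrees m and n.  If m + n is even, then       *)
(* [alpha, beta] lies in odd degree and vanishes; if m + n is odd, then one   *)
(* of alpha, beta vanishes, and so does the bracket since it is well defined  *)
(* on cohomology.  Well-definedness rests on the pre-Lie identity for the     *)
(* insertion product and on f |-> \sum f(a_11, ..., a_n1) a_12 ... a_n2 being *)
(* a chain map inverse to the Eckmann-Shapiro map.                            *)

(** For (1), grade [T] by the degree in x. Bracketing with the Euler derivation [D] multiplies a
    homogeneous cochain by its degree. The cocycle [xi] of the deformation x^p = t has degree -p,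
    and p is invertible in characteristic 0, so [D, xi] = -p xi is a nonzero class once [xi] is. A
    coboundary evaluated at (x, x^(p-1)) lies in the kernel of [eps] because x^p = 0, whereas [xi]
    takes the value 1 there ([taft_euler_derivation], [taft_deformation_cocycle],
    [taft_HH_bracket_nonzero]).

    For (2), the bracket has degree -1 and H^n(T_p, k) vanishes for odd n ([taft_ext_odd]), so every
    bracket either lands in odd degree or has an argument of odd degree
    ([hopf_bracket_odd_vanishing]). The second case requires that the bracket respect coboundaries.
    Up to sign the Hochschild differential is the bracket with the multiplication, so the Leibniz
    rule [HH_diff_gbracket] follows from the pre-Lie identity [compose_prelie];
    [shapiro_inv_bar_diff] carries coboundaries across the Eckmann-Shapiro isomorphism. The odd
    vanishing is an induction by steps of two: averaging over the group generated by g makes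
    coinduced modules acyclic ([coind_acyclic]), [ext_dimension_shift] lowers the degree by two, and
    [taft_ext1] is the base.

    Computations in [T] use the basis g^i x^j, derived from the universal property: matrix
    representations provide the coordinate functions, and [taft_generated] gives spanning. *)

Lemma split_at (T : Type) (i : nat) (s : seq T) : (i <= size s)%N ->
  exists s1 s2, s = s1 ++ s2 /\ size s1 = i.
Proof.
by move=> le_i; exists (take i s), (drop i s); rewrite cat_take_drop size_takel.
Qed.

Ltac split_word w n s w' :=
  let wE := fresh in let sE := fresh "sE" in
  have [s [w' [wE sE]]] := @split_at _ n w ltac:(lia);
  subst w;
  repeat match goal with
  | H : context [size (_ ++ _)] |- _ => rewrite size_cat in H
  end.

Ltac case_parity :=
  rewrite ?(oddD, oddM) /= ?(oddD, oddM) /=;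
  repeat match goal with |- context [odd ?n] => case: (odd n) end.

(** * Partial insertion of a cochain into a word *)

Section Insertion.
Variable A : Type.
Implicit Types (w s t : seq A) (g h : seq A -> A).

Definition ins (i n : nat) h w : seq A :=
  take i w ++ h (take n (drop i w)) :: drop (i + n) w.

Lemma ins_cat i n h s t w : size s = i -> size t = n ->
  ins i n h (s ++ t ++ w) = s ++ h t :: w.
Proof.
move=> <- <-; rewrite /ins addnC -drop_drop take_size_cat // drop_size_cat //.
by rewrite take_size_cat // drop_size_cat.
Qed.

Lemma size_ins i n h w : (i + n <= size w)%N ->
  size (ins i n h w) = (size w - n).+1.
Proof.
move=> le_w; rewrite /ins size_cat /= size_drop size_take; case: ifP; lia.
Qed.

Lemma eq_ins i n h h' w : (i + n <= size w)%N ->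
  (forall t, size t = n -> h t = h' t) -> ins i n h w = ins i n h' w.
Proof.
by move=> le_w eq_h; rewrite /ins eq_h // size_takel // size_drop; lia.
Qed.

(** The two blocks are disjoint, so the order is immaterial. Collapsing the [n] letters of the left
    block to one shifts the right block by n - 1, hence the position [i.-1 + n]. *)
Lemma ins_ins_lt i j m n g h w : (j < i)%N -> (i.-1 + n + m <= size w)%N ->
  ins i m g (ins j n h w) = ins j n h (ins (i.-1 + n) m g w).
Proof.
move=> lt_ji le_w.
split_word w j s1 w1.
split_word w1 n s2 w2.
split_word w2 (i.-1 - j)%N s3 w3.
split_word w3 m s4 w4.
rewrite ins_cat // (_ : s1 ++ h s2 :: _ = (s1 ++ h s2 :: s3) ++ s4 ++ w4);
  last first.
  by rewrite -catA.
rewrite ins_cat //; last by rewrite size_cat /=; lia.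
rewrite (_ : s1 ++ s2 ++ s3 ++ s4 ++ w4 = (s1 ++ s2 ++ s3) ++ s4 ++ w4);
  last first.
  by rewrite -!catA.
rewrite (ins_cat (i := i.-1 + n)%N) //; last by rewrite !size_cat /=; lia.
by rewrite -!catA ins_cat.
Qed.

(** Associativity of partial composition: the letter produced by [h] lies inside the block consumed
    by [g]. *)
Lemma ins_ins_nested i j m n g h w : (j < m)%N ->
  (i + (m + n).-1 <= size w)%N ->
  ins i m g (ins (j + i) n h w)
  = ins i (m + n).-1 (fun t => g (ins j n h t)) w.
Proof.
move=> lt_jm le_w.
split_word w i s1 w1.
split_word w1 j s2 w2.
split_word w2 n s3 w3.
split_word w3 (m - j.+1)%N s4 w4.
rewrite (_ : s1 ++ s2 ++ s3 ++ s4 ++ w4 = (s1 ++ s2) ++ s3 ++ s4 ++ w4);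
  last first.
  by rewrite -!catA.
rewrite ins_cat //; last by rewrite size_cat; lia.
rewrite (_ : (s1 ++ s2) ++ h s3 :: s4 ++ w4 = s1 ++ (s2 ++ h s3 :: s4) ++ w4);
  last first.
  by rewrite -!catA.
rewrite ins_cat //; last by rewrite size_cat /=; lia.
rewrite (_ : (s1 ++ s2) ++ s3 ++ s4 ++ w4 = s1 ++ (s2 ++ s3 ++ s4) ++ w4);
  last first.
  by rewrite -!catA.
by rewrite ins_cat // ?ins_cat // !size_cat /=; lia.
Qed.

End Insertion.

(** * Multilinear cochains and the insertion product *)

Section Multilinear.
Variables (k : fieldType) (A M : lmodType k).
Implicit Types (w s t : seq A) (f : seq A -> M) (h : seq A -> A).

Lemma multilinear0 n f s t : multilinear n f -> (size s + size t).+1 = n ->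
  f (s ++ 0 :: t) = 0.
Proof.
move=> lin_f /lin_f /(_ (-1) 0 0) /=.
by rewrite scaler0 addr0 scaleN1r addNr.
Qed.

Lemma multilinear_sum n f (I : Type) (r : seq I) (c : I -> k) (a : I -> A) s t :
  multilinear n f -> (size s + size t).+1 = n ->
  f (s ++ (\sum_(i <- r) c i *: a i) :: t)
  = \sum_(i <- r) c i *: f (s ++ a i :: t).
Proof.
move=> lin_f szE; elim: r => [|i r IH].
  by rewrite !big_nil (multilinear0 lin_f).
by rewrite !big_cons lin_f // IH.
Qed.

Lemma multilinear_ext n f f' : multilinear n f ->
  (forall w, size w = n -> f w = f' w) -> multilinear n f'.
Proof.
move=> lin_f eq_f s t szE c u v.
by rewrite -!eq_f ?size_cat /= ?addnS // lin_f.
Qed.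

Lemma multilinear_const0 n : multilinear n (fun _ : seq A => 0 : M).
Proof. by move=> s t _ c u v; rewrite scaler0 addr0. Qed.

Lemma multilinearD n f f' : multilinear n f -> multilinear n f' ->
  multilinear n (fun w => f w + f' w).
Proof.
move=> lin_f lin_f' s t szE c u v.
by rewrite lin_f // lin_f' // scalerDr addrACA.
Qed.

Lemma multilinearZ n c f : multilinear n f -> multilinear n (fun w => c *: f w).
Proof.
move=> lin_f s t szE d u v.
by rewrite lin_f // scalerDr !scalerA mulrC.
Qed.

Lemma multilinearN n f : multilinear n f -> multilinear n (fun w => - f w).
Proof.
move=> lin_f; apply: (multilinear_ext (multilinearZ (-1) lin_f)) => w _.
by rewrite scaleN1r.
Qed.

Lemma multilinearB n f f' : multilinear n f -> multilinear n f' ->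
  multilinear n (fun w => f w - f' w).
Proof. by move=> lin_f lin_f'; apply/multilinearD/multilinearN. Qed.

Lemma multilinear_bigsum n (I : finType) (f : I -> seq A -> M) :
  (forall i, multilinear n (f i)) -> multilinear n (fun w => \sum_i f i w).
Proof.
move=> lin_f s t szE c u v; rewrite scaler_sumr -big_split.
by apply: eq_bigr => i _; apply: lin_f.
Qed.

(** The varying letter lies to the left of the inserted block, inside it, or to its right. Linearity
    comes from [f] in the outer cases and from [h] followed by [f] in the middle one. *)
Lemma multilinear_ins l n i f h : (i < l)%N -> multilinear l f ->
  multilinear n h -> multilinear (l + n).-1 (fun w => f (ins i n h w)).
Proof.
move=> lt_il lin_f lin_h s t szE c u v.
have [lt_si|le_is] := ltnP (size s) i.
  split_word t (i - (size s).+1)%N t1 t'.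
  split_word t' n t2 t3.
  have insE a : ins i n h (s ++ a :: t1 ++ t2 ++ t3)
    = s ++ a :: t1 ++ h t2 :: t3.
    rewrite -cat_cons catA ins_cat //; last by rewrite size_cat /=; lia.
    by rewrite -catA.
  by rewrite !insE lin_f //= size_cat /=; lia.
split_word s i s1 s'.
have [lt_sn|le_sn] := ltnP (size s') n.
  split_word t (n - (size s').+1)%N t1 t2.
  have insE a : ins i n h ((s1 ++ s') ++ a :: t1 ++ t2)
    = s1 ++ h (s' ++ a :: t1) :: t2.
    rewrite -cat_cons -catA [X in s1 ++ X]catA ins_cat // size_cat /=; lia.
  by rewrite !insE lin_h ?lin_f //; lia.
split_word s' n s2 s3.
have insE a : ins i n h ((s1 ++ s2 ++ s3) ++ a :: t)
  = (s1 ++ h s2 :: s3) ++ a :: t.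
  by rewrite -!catA ins_cat.
by rewrite !insE lin_f // size_cat /=; lia.
Qed.

(** The product [circ], but with values of [f] in an arbitrary module, so that bar differentials
    with coefficients can also be written as insertions. *)
Definition compose (l n : nat) f h w : M :=
  \sum_(i < l) (-1) ^+ (n.+1 * i) *: f (ins i n h w).

Lemma multilinear_compose l n f h : multilinear l f -> multilinear n h ->
  multilinear (l + n).-1 (compose l n f h).
Proof.
move=> lin_f lin_h; apply: multilinear_bigsum => i.
exact/multilinearZ/multilinear_ins.
Qed.

Lemma eq_compose l n f f' h h' w : (size w).+1 = (l + n)%N ->
  (forall v, size v = l -> f v = f' v) -> (forall v, size v = n -> h v
    = h' v) ->
  compose l n f h w = compose l n f' h' w.
Proof.
move=> szw eq_f eq_h; apply: eq_bigr => i _; have lt_il := ltn_ord i.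
rewrite (eq_ins _ eq_h) ?eq_f // ?size_ins //; lia.
Qed.

Lemma composeZl l n c f h w :
  compose l n (fun v => c *: f v) h w = c *: compose l n f h w.
Proof.
by rewrite scaler_sumr; apply: eq_bigr => i _; rewrite !scalerA mulrC.
Qed.

Lemma composeDZr l n c f h h' w : multilinear l f -> (size w).+1 = (l + n)%N ->
  compose l n f (fun v => c *: h v + h' v) w
  = c *: compose l n f h w + compose l n f h' w.
Proof.
move=> lin_f szw; rewrite scaler_sumr -big_split; apply: eq_bigr => i _ /=.
have lt_il := ltn_ord i.
rewrite /ins lin_f ?scalerDr ?scalerA 1?mulrC // size_drop size_take.
by case: ifP; lia.
Qed.

Lemma composeZr l n c f h w : multilinear l f -> (size w).+1 = (l + n)%N ->
  compose l n f (fun v => c *: h v) w = c *: compose l n f h w.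
Proof.
move=> lin_f szw; rewrite scaler_sumr; apply: eq_bigr => i _ /=.
have lt_il := ltn_ord i.
have := @multilinear_sum l f _ [:: tt] (fun=> c) (fun=> h (take n (drop i w)))
   (take i w) (drop (i + n) w) lin_f; rewrite !big_seq1 /ins => ->.
  by rewrite !scalerA mulrC.
rewrite size_drop size_take; case: ifP; lia.
Qed.

Lemma composeBl l n f f' h w :
  compose l n (fun v => f v - f' v) h w = compose l n f h w - compose l n f' h
    w.
Proof. by rewrite -sumrB; apply: eq_bigr => i _; rewrite scalerBr. Qed.

Lemma composeBr l n f h h' w : multilinear l f -> (size w).+1 = (l + n)%N ->
  compose l n f (fun v => h v - h' v) w = compose l n f h w - compose l n f h'
    w.
Proof.
move=> lin_f szw; have := composeDZr (-1) h' h lin_f szw.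
rewrite scaleN1r addrC => <-; apply: eq_bigr => i _; congr (_ *: f _).
by rewrite /ins scaleN1r addrC.
Qed.

Lemma signr_eq (m n : nat) : odd m = odd n -> (-1) ^+ m = (-1) ^+ n :> k.
Proof. by rewrite -signr_odd => ->; rewrite signr_odd. Qed.

(** The terms in which [g] and [h] fill two different arguments of [f], with [h] to the left: a
    signed brace operation f{h, g}. *)
Definition cross (l m n : nat) f g h w : M :=
  \sum_(i < l) \sum_(j < i)
    (-1) ^+ (m.+1 * i + n.+1 * j) *: f (ins i m g (ins j n h w)).

Lemma triangular_exchange (l : nat) (F : nat -> nat -> M) :
  \sum_(i < l) \sum_(i <= j < l.-1) F i j = \sum_(j < l) \sum_(i < j) F i j.-1.
Proof.
case: l => [|l /=]; first by rewrite !big_ord0.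
rewrite [RHS]big_ord_recl big_ord0 add0r [LHS]big_ord_recr /= big_geq // addr0.
under eq_bigr => i _ do rewrite (big_nat_widenl _ 0) // big_mkord.
rewrite (exchange_big_dep predT) //=; apply: eq_bigr => j _.
rewrite -(big_mkord xpredT (fun i => F i j)) /=.
by rewrite (big_nat_widen _ _ l) ?ltn_ord // big_mkord.
Qed.

End Multilinear.

(** The pre-Lie identity: the associator of insertion is graded symmetric in [g] and [h]. The terms
    are sorted by whether [h] lands inside the block of [g], to its left or to its right. Positivity
    of m + n keeps [(m + n).-1] of the parity of m + n - 1. *)
Lemma compose_prelie (k : fieldType) (A M : lmodType k) (l m n : nat)
    (f : seq A -> M) (g h : seq A -> A) w :
  (0 < m + n)%N -> multilinear l f -> (size w).+2 = (l + m + n)%N ->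
  compose (l + m).-1 n (compose l m f g) h w
  = compose l (m + n).-1 f (compose m n g h) w
    + cross l m n f g h w + (-1) ^+ (m.+1 * n.+1) *: cross l n m f h g w.
Proof.
move=> mn_gt0 lin_f szw.
pose F i j := (-1) ^+ (n.+1 * j + m.+1 * i) *: f (ins i m g (ins j n h w)).
have -> : compose (l + m).-1 n (compose l m f g) h w
    = \sum_(i < l) \sum_(0 <= j < (l + m).-1) F i j.
  rewrite exchange_big big_mkord; apply: eq_bigr => j _.
  by rewrite scaler_sumr; apply: eq_bigr => i _; rewrite scalerA -exprD.
(* The three ranges of j: inside the block of [g], left of it, and right of it, the last one shifted
   down by m. *)
have splitF (i : 'I_l) : \sum_(0 <= j < (l + m).-1) F i j
    = \sum_(0 <= j < m) F i (j + i)%N + \sum_(j < i) F i j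
      + \sum_(i <= j < l.-1) F i (j + m)%N.
  have lt_il := ltn_ord i.
  rewrite (@big_cat_nat _ _ _ i) //=; last by lia.
  rewrite (@big_cat_nat _ _ _ (i + m) i) //=; [|lia|lia].
  rewrite addrA big_mkord [X in X + _]addrC; congr (_ + _ + _).
    by rewrite -{1}[i : nat]add0n big_addn addKn.
  by rewrite big_addn; congr (\sum_(i <= j < _) _); lia.
under eq_bigr => i _ do rewrite splitF.
rewrite !big_split /=; congr (_ + _ + _); last first.
- rewrite (triangular_exchange l (fun i j => F i (j + m)%N)) scaler_sumr;
  apply: eq_bigr => j _.
  rewrite scaler_sumr; apply: eq_bigr => i _; rewrite scalerA -exprD.
  have lt_jl := ltn_ord j; have lt_ij := ltn_ord i.
  rewrite /F -ins_ins_lt //; last by lia.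
  congr (_ *: _); apply: signr_eq.
  have oddj : odd j = ~~ odd j.-1 by rewrite -{1}(ltn_predK lt_ij).
  rewrite !(oddD, oddM) /= oddj.
  by case_parity.
- apply: eq_bigr => i _; apply: eq_bigr => j _.
  by rewrite /F addnC.
apply: eq_bigr => i _; have lt_il := ltn_ord i.
rewrite /ins /compose (multilinear_sum _ _ _ lin_f); last first.
  by rewrite size_drop size_takel; lia.
rewrite scaler_sumr big_mkord; apply: eq_bigr => j _; have lt_jm := ltn_ord j.
rewrite /F ins_ins_nested //; last by lia.
rewrite /ins scalerA -exprD; congr (_ *: _); apply: signr_eq.
rewrite prednK // !(oddD, oddM) /=.
by case_parity.
Qed.

(* Identities valid in every abelian group are decided by comparing the       *)
(* integer coefficients of the atoms: [ring] would require a ring structure.  *)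
Inductive zexpr := ZVar of nat | ZAdd of zexpr & zexpr | ZOpp of zexpr | ZZero.

Fixpoint zeval (V : zmodType) (env : seq V) e : V :=
  match e with
  | ZVar i => env`_i
  | ZAdd e1 e2 => zeval env e1 + zeval env e2
  | ZOpp e1 => - zeval env e1
  | ZZero => 0
  end.

Fixpoint zcoef e (i : nat) : int :=
  match e with
  | ZVar j => (i == j)%:R
  | ZAdd e1 e2 => zcoef e1 i + zcoef e2 i
  | ZOpp e1 => - zcoef e1 i
  | ZZero => 0
  end.

Lemma zeval_coef (V : zmodType) (env : seq V) e :
  zeval env e = \sum_(i < size env) env`_i *~ zcoef e i.
Proof.
elim: e => [j|e1 IH1 e2 IH2|e IH|] /=.
- have [lt_j|le_j] := ltnP j (size env); last first.
    rewrite nth_default // big1 // => i _.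
    by rewrite ltn_eqF ?mulr0z // (leq_trans (ltn_ord i)).
  rewrite (bigD1 (Ordinal lt_j)) //= eqxx mulr1z big1 ?addr0 // => i.
  by rewrite -val_eqE /= => /negPf ->; rewrite mulr0z.
- by rewrite IH1 IH2 -big_split; apply: eq_bigr => i _; rewrite mulrzDr.
- by rewrite IH -sumrN; apply: eq_bigr => i _; rewrite mulrNz.
- by rewrite big1 // => i _; rewrite mulr0z.
Qed.

Lemma zexpr_eq (V : zmodType) (env : seq V) e1 e2 :
  all (fun i => zcoef e1 i == zcoef e2 i) (iota 0 (size env)) ->
  zeval env e1 = zeval env e2.
Proof.
move=> /allP eq_c; rewrite !zeval_coef; apply: eq_bigr => i _.
by rewrite (eqP (eq_c i _)) // mem_iota ltn_ord.
Qed.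

Ltac zindex x env :=
  lazymatch env with
  | x :: _ => constr:(0%N)
  | _ :: ?env' => let i := zindex x env' in constr:(i.+1)
  end.
Ltac zinsert x env :=
  lazymatch env with
  | context [x :: _] => env
  | _ => constr:(x :: env)
  end.
Ltac zatoms t env :=
  lazymatch t with
  | (?a + ?b)%R => let env1 := zatoms a env in zatoms b env1
  | (- ?a)%R => zatoms a env
  | 0%R => env
  | _ => zinsert t env
  end.
Ltac zreify t env :=
  lazymatch t with
  | (?a + ?b)%R =>
      let ea := zreify a env in let eb := zreify b env in constr:(ZAdd ea eb)
  | (- ?a)%R => let ea := zreify a env in constr:(ZOpp ea)
  | 0%R => constr:(ZZero)
  | _ => let i := zindex t env in constr:(ZVar i)
  end.
Ltac zmodule :=
  lazymatch goal with |- @eq ?V ?a ?b =>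
    let env0 := zatoms a (@nil V) in
    let env := zatoms b env0 in
    let ea := zreify a env in let eb := zreify b env in
    exact: (@zexpr_eq _ env ea eb isT)
  end.

(** The type argument of [size] may appear in several convertible forms; a single form lets [lia]
    recognise equal sizes as the same atom. *)
Ltac norm_size := repeat match goal with
  | s : list ?U |- _ => progress change (@size _ s) with (@size U s) in *
  end.

(** * The multiplication as a 2-cochain *)

Section Mul2.
Variables (k : fieldType) (A : algType k) (M : lmodType k).

Definition mul2 (w : seq A) : A := w`_0 * w`_1.

Lemma multilinear_mul2 : multilinear 2 mul2.
Proof.
move=> [|a [|b s]] [|c [|d t]] //= _ e u v; rewrite /mul2 /=.
  by rewrite mulrDl scalerAl.
by rewrite mulrDr scalerAr.
Qed.

Lemma compose_mul2 l (f : seq A -> M) w : (size w = l.+1)%N ->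
  compose l 2 f mul2 w
  = \sum_(i < l) (-1) ^+ i *: f (take i w ++ (w`_i * w`_i.+1) :: drop i.+2 w).
Proof.
move=> szw; apply: eq_bigr => i _; congr (_ *: f _).
  by apply: signr_eq; rewrite oddM.
by rewrite /ins /mul2 !nth_take // !nth_drop addn0 addn1 addn2.
Qed.

(** In the pre-Lie identity with both inserted cochains equal to the multiplication, the sign is -1,
    so the cross terms cancel. What remains is the insertion of the associator, which is zero. *)
Lemma compose_mul2_mul2 l (f : seq A -> M) w : multilinear l f ->
  size w = l.+2 -> compose l.+1 2 (compose l 2 f mul2) mul2 w = 0.
Proof.
move=> lin_f szw; have := compose_prelie (l := l) (m := 2) (n
  := 2) mul2 mul2 (w := w) isT lin_f.
rewrite !addn2 /= szw => -> //.
rewrite (@signr_eq k _ 1) // expr1 scaleN1r addrK.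
rewrite (@eq_compose _ _ _ l 3 f f _ (fun=> 0)) //; last 2 first.
- by lia.
- move=> [|a [|b [|c []]]] // _.
  rewrite /compose !big_ord_recl big_ord0 /ins /mul2 /= scale1r addr0 mulrA.
  by rewrite (@signr_eq k _ 1) // scaleN1r subrr.
rewrite /compose big1 // => i _; have lt_il := ltn_ord i.
rewrite (multilinear0 lin_f) ?scaler0 //.
by rewrite size_drop size_take; case: ifP; lia.
Qed.
End Mul2.

(** * The bar differential with coefficients in a bimodule *)

Record bimodule (k : fieldType) (A : algType k) (M : lmodType k)
    (lact : A -> M -> M) (ract : M -> A -> M) : Prop := Bimodule {
  lact_linearl : forall m, linear (lact^~ m);
  lact_linearr : forall a, linear (lact a);
  ract_linearl : forall a, linear (ract^~ a);
  ract_linearr : forall m, linear (ract m);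
  lact_mul : forall a b m, lact (a * b) m = lact a (lact b m);
  ract_mul : forall a b m, ract m (a * b) = ract (ract m a) b;
  lact_ract : forall a b m, lact a (ract m b) = ract (lact a m) b;
  lact1 : forall m, lact 1 m = m;
  ract1 : forall m, ract m 1 = m }.

Section BarDifferential.
Variables (k : fieldType) (A : algType k) (M : lmodType k).
Variables (lact : A -> M -> M) (ract : M -> A -> M).
Hypothesis bimodM : bimodule lact ract.
Local Notation d := (bar_diff lact ract).
Implicit Types (f : seq A -> M) (w : seq A).

Lemma eq_bar_diff n f f' w : (forall v, size v = n -> f v = f' v) ->
  size w = n.+1 -> d n f w = d n f' w.
Proof.
move=> eq_f szw; rewrite /bar_diff !eq_f ?size_behead ?szw ?size_takel ?szw //.
congr (_ + _ + _); apply: eq_bigr => i _; have lt_in := ltn_ord i.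
by rewrite eq_f // size_cat /= size_drop size_take; case: ifP; lia.
Qed.

Lemma bar_diffDZ n c f f' w :
  d n (fun v => c *: f v + f' v) w = c *: d n f w + d n f' w.
Proof.
rewrite /bar_diff (lact_linearr bimodM) (ract_linearl bimodM) !scalerDr.
have -> (x y z x' y' z' : M) : x + y + z + (x' + y' + z')
  = (x + x') + (y + y') + (z + z').
  by zmodule.
congr (_ + _ + (_ + _)); last by rewrite !scalerA mulrC.
rewrite scaler_sumr -big_split; apply: eq_bigr => i _.
by rewrite scalerDr !scalerA mulrC.
Qed.

Lemma bar_diff0 n w : d n (fun=> 0) w = 0.
Proof.
have := bar_diffDZ n (-1) (fun=> 0) (fun=> 0) w.
by rewrite scaler0 addr0 scaleN1r addNr.
Qed.

Lemma bar_diffZ n c f w : d n (fun v => c *: f v) w = c *: d n f w.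
Proof.
have <- : d n (fun v => c *: f v + 0) w = c *: d n f w.
  by rewrite bar_diffDZ bar_diff0 addr0.
rewrite /bar_diff !addr0; congr (_ + _ + _).
by apply: eq_bigr => i _; rewrite addr0.
Qed.

Lemma bar_diffD n f f' w : d n (fun v => f v + f' v) w = d n f w + d n f' w.
Proof.
rewrite -[d n f w]scale1r -bar_diffDZ /bar_diff !scale1r; congr (_ + _ + _).
by apply: eq_bigr => i _; rewrite scale1r.
Qed.

Lemma bar_diffB n f f' w : d n (fun v => f v - f' v) w = d n f w - d n f' w.
Proof.
rewrite bar_diffD -[- d n f' w]scaleN1r -bar_diffZ /bar_diff !scaleN1r.
by under [in X in _ = _ + (_ + X + _)]eq_bigr => i _ do rewrite scaleN1r.
Qed.

(* The A^e-linear extension b_0 f(b_1, ..., b_n) b_{n+1} of f; on it the bar  *)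
(* differential is the insertion of the multiplication.                       *)
Definition bar_ext (n : nat) f w : M :=
  lact w`_0 (ract (f (take n (behead w))) w`_n.+1).

Lemma bar_extE n f a v b : size v = n ->
  bar_ext n f (a :: rcons v b) = lact a (ract (f v) b).
Proof.
by move=> szv; rewrite /bar_ext /= nth_rcons szv ltnn eqxx -cats1 take_size_cat.
Qed.

Lemma multilinear_bar_ext n f : multilinear n f
  -> multilinear n.+2 (bar_ext n f).
Proof.
move=> lin_f [|a s] t /= szE c u v.
  case/lastP: t szE => // t b; rewrite size_rcons => -[szt].
  by rewrite !bar_extE // (lact_linearl bimodM).
case/lastP: t szE => [|t b] szE.
  have szs : size s = n by move: szE; rewrite addn0 => -[].
  by rewrite !cats1 !bar_extE // (ract_linearr bimodM) (lact_linearr bimodM).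
have szst : (size s + size t).+1 = n by move: szE;
  rewrite size_rcons addnS => -[].
rewrite -!rcons_cons -!rcons_cat !bar_extE ?size_cat /= ?addnS //.
by rewrite lin_f // (ract_linearl bimodM) (lact_linearr bimodM).
Qed.

(** The product of the first two letters yields the left action term, that of the last two the right
    action term, and the others the inner sum. *)
Lemma compose_bar_ext n f w : size w = n.+3 ->
  compose n.+2 2 (bar_ext n f) (@mul2 k A) w = bar_ext n.+1 (d n f) w.
Proof.
case: w => // a w; case/lastP: w => // v b; rewrite /= size_rcons => -[szv].
rewrite compose_mul2 /= ?size_rcons ?szv // bar_extE //.
rewrite big_ord_recl big_ord_recr /= scale1r /bar_diff.
have lactD x y z : lact z (x + y) = lact z x + lact z y.
  by have := lact_linearr bimodM z 1 x y; rewrite !scale1r.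
have ractD x y z : ract (x + y) z = ract x z + ract y z.
  by have := ract_linearl bimodM z 1 x y; rewrite !scale1r.
have lact0 z : lact z 0 = 0.
  by have := lact_linearr bimodM z (-1) 0 0;
    rewrite scaler0 addr0 scaleN1r addNr.
have ract0 z : ract 0 z = 0.
  by have := ract_linearl bimodM z (-1) 0 0;
    rewrite /= scaler0 addr0 scaleN1r addNr.
have lactZ c x z : lact z (c *: x) = c *: lact z x.
  by have := lact_linearr bimodM z c x 0; rewrite !(addr0, lact0).
have ractZ c x z : ract (c *: x) z = c *: ract x z.
  by have := ract_linearl bimodM z c x 0; rewrite /= !(addr0, ract0).
rewrite !(ractD, lactD, ractZ, lactZ) [LHS]addrA; congr (_ + _ + _).
- case: v szv => //= v0 v [szv].
  by rewrite drop0 bar_extE // (lact_mul bimodM) (lact_ract bimodM).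
- rewrite (big_morph (ract^~ b) (fun x y => ractD x y b) (ract0 b)).
  rewrite (big_morph (lact a) (fun x y => lactD x y a) (lact0 a)).
  apply: eq_bigr => i _; have lt_in := ltn_ord i.
  rewrite ractZ lactZ; congr (_ *: _).
  rewrite /bump leq0n add0n add1n -!cats1 takel_cat ?szv ?(leqW (ltnW lt_in))
    //.
  rewrite !nth_cat szv !ltnS lt_in (ltnW lt_in) /=.
  rewrite drop_cat szv !ltnS; case: ltnP => lt_i.
    by rewrite cats1 -rcons_cons -rcons_cat bar_extE // size_cat /= size_takel
      ?size_drop szv; lia.
  rewrite (_ : i.+2 - n.+1 = 0)%N ?drop0; last by lia.
  rewrite -[_ :: [:: b]]/(rcons [:: _] b) -rcons_cat bar_extE; last first.
    by rewrite size_cat /= size_takel ?szv; lia.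
  by rewrite [in RHS]drop_oversize ?szv; last by lia.
congr (_ *: _).
rewrite /bump leq0n add0n add1n drop_oversize ?size_rcons ?szv // cats1
  bar_extE; last first.
  by rewrite size_takel // size_rcons szv; lia.
by rewrite -!cats1 takel_cat ?szv // !nth_cat szv !ltnS leqnn ltnn subnn
  (ract_mul bimodM).
Qed.

(** Padding with units on both sides undoes [bar_ext], so facts on insertion pass to the
    differential. *)
Lemma bar_diff_compose n f w : size w = n.+1 ->
  d n f w = compose n.+2 2 (bar_ext n f) (@mul2 k A) (1 :: rcons w 1).
Proof.
move=> szw; rewrite compose_bar_ext; last by rewrite /= size_rcons szw.
by rewrite bar_extE // (lact1 bimodM) (ract1 bimodM).
Qed.

Lemma multilinear_bar_diff n f : multilinear n f -> multilinear n.+1 (d n f).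
Proof.
move=> lin_f; have lin := multilinear_compose (multilinear_bar_ext lin_f)
  (@multilinear_mul2 k A).
rewrite addn2 /= in lin.
move=> s t szE c u v.
have sz a : size (s ++ a :: t) = n.+1 by rewrite size_cat /= addnS.
rewrite !bar_diff_compose // !rcons_cat !rcons_cons -!cat_cons.
by rewrite lin //= size_rcons addSn addnS szE.
Qed.

Lemma bar_diff_bar_diff n f w : multilinear n f -> size w = n.+2 ->
  d n.+1 (d n f) w = 0.
Proof.
move=> lin_f szw; rewrite bar_diff_compose //.
rewrite (@eq_compose _ _ _ _ _ _ (compose n.+2 2 (bar_ext n f) (@mul2 k A)) _
  (@mul2 k A)) //.
- apply: compose_mul2_mul2; first exact: multilinear_bar_ext.
  by rewrite /= size_rcons szw.
- by rewrite /= size_rcons szw addn2.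
by move=> v szv; rewrite compose_bar_ext.
Qed.
End BarDifferential.

Lemma bar_diff_map (k : fieldType) (A : algType k) (M N : lmodType k)
    (lactM : A -> M -> M) (ractM : M -> A -> M)
    (lactN : A -> N -> N) (ractN : N -> A -> N) (phi : M -> N) n
    (f : seq A -> M) w :
  linear phi -> (forall a m, phi (lactM a m) = lactN a (phi m)) ->
  (forall a m, phi (ractM m a) = ractN (phi m) a) ->
  bar_diff lactN ractN n (fun v => phi (f v)) w
  = phi (bar_diff lactM ractM n f w).
Proof.
move=> lin_phi phi_lact phi_ract.
have phiD x y : phi (x + y) = phi x + phi y.
  by have := lin_phi 1 x y; rewrite !scale1r.
have phi0 : phi 0 = 0.
  by have := lin_phi (-1) 0 0; rewrite scaler0 addr0 scaleN1r addNr.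
have phiZ c x : phi (c *: x) = c *: phi x.
  by have := lin_phi c x 0; rewrite !(addr0, phi0).
rewrite /bar_diff !phiD phiZ phi_lact phi_ract (big_morph phi phiD phi0).
by congr (_ + _ + _); apply: eq_bigr => i _; rewrite phiZ.
Qed.

Lemma multilinear_map (k : fieldType) (A M N : lmodType k) (phi : M -> N) n
    (f : seq A -> M) :
  linear phi -> multilinear n f -> multilinear n (fun w => phi (f w)).
Proof. by move=> lin_phi lin_f s t szE c u v; rewrite lin_f // lin_phi. Qed.

(** * The Gerstenhaber bracket on Hochschild cohomology *)

Section Gerstenhaber.
Variables (k : fieldType) (A : algType k).
Implicit Types (f h : seq A -> A) (w : seq A).

Lemma bimodule_regular :
  bimodule (k := k) (fun a b : A => a * b) (fun b a : A => b * a).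
Proof.
split=> [m c u v|a c u v|a c u v|m c u v|a b m|a b m|a b m|m|m] /=;
  rewrite ?mul1r ?mulr1 ?mulrA // ?(mulrDl, mulrDr) ?scalerAl //.
  by rewrite -scalerAl scalerAr.
by rewrite -scalerAl scalerAr.
Qed.

Local Notation d := (bar_diff (fun a b : A => a * b) (fun b a : A => b * a)).
Local Notation mu := (@mul2 k A).

Lemma circ_compose m n f h w : circ m n f h w = compose m n f h w.
Proof. by []. Qed.

(** This is d f = (-1)^(n+1) [mu, f]: the two terms of the insertion of [f] into the product are the
    outer terms of the differential. *)
Lemma HH_diff_compose n f w : size w = n.+1 ->
  d n f w = (-1) ^+ n.+1 *: compose 2 n mu f w - compose n 2 f mu w.
Proof.
move=> szw; rewrite compose_mul2 // /bar_diff -sumrN.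
rewrite {1}/compose !big_ord_recl big_ord0 /ins /mul2 /= addr0 muln0 muln1.
rewrite scale1r !take0 !drop0 /= scalerDr scalerA -expr2 sqrr_sign scale1r.
rewrite /bump leq0n !addn0 !add0n !add1n nth_drop addn0 drop1.
rewrite addrAC [X in X + _]addrC; congr (_ + _ + _); last first.
  by apply: eq_bigr => i _; rewrite exprS mulN1r scaleNr.
have -> : take n (behead w) = behead w by rewrite take_oversize // size_behead
  szw.
by case: w szw => // a w _; rewrite /= take0.
Qed.

(** The Leibniz rule, a form of the graded Jacobi identity with mu as third argument. Both sides
    expand into double insertions of mu, [f] and [h], which the pre-Lie identity compares. *)
Lemma HH_diff_gbracket m n f h w : multilinear m f -> multilinear n h ->
  (0 < m + n)%N -> size w = (m + n)%N ->
  d (m + n).-1 (gbracket m n f h) w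
  = (-1) ^+ n.+1 *: gbracket m.+1 n (d m f) h w + gbracket m n.+1 f (d n h) w.
Proof.
move=> lin_f lin_h mn_gt0 szw; have lin_mu := @multilinear_mul2 k A.
have eq_d q u v : size v = q.+1 ->
  d q u v = (-1) ^+ q.+1 *: compose 2 q mu u v - compose q 2 u mu v.
  exact: HH_diff_compose.
have szw1 : size w = (m + n).-1.+1 by rewrite prednK.
rewrite eq_d // /gbracket !circ_compose.
rewrite (composeBr (l := 2)) ?szw1 // composeBl.
rewrite (composeZr (l := 2)) ?szw1 // composeZl.
rewrite (@eq_compose _ _ _ m.+1 n _ _ h h w _ (eq_d m f)) ?szw //.
rewrite (@eq_compose _ _ _ n m.+1 h h _ _ w _ _ (eq_d m f)) //; last first.
  by rewrite szw; lia.
rewrite (@eq_compose _ _ _ m n.+1 f f _ _ w _ _ (eq_d n h)) //; last first.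
  by rewrite szw; lia.
rewrite (@eq_compose _ _ _ n.+1 m _ _ f f w _ (eq_d n h)) //; last first.
  by rewrite szw; lia.
rewrite (composeBr _ _ lin_f) ?(composeZr _ _ lin_f); try by rewrite szw; lia.
rewrite (composeBr _ _ lin_h) ?(composeZr _ _ lin_h); try by rewrite szw; lia.
rewrite !composeBl !composeZl.
(* One instance for each order of insertion into mu, [f] and [h]. Primes exchange the two inserted
   cochains in the last two pairs, and [f] with [h] in the first; each pair shares its cross
   terms. *)
have P1 : compose m.+1 n (compose 2 m mu f) h w
    = compose 2 (m + n).-1 mu (compose m n f h) w + cross 2 m n mu f h w
      + (-1) ^+ (m.+1 * n.+1) *: cross 2 n m mu h f w.
  by apply: (compose_prelie (l := 2)); rewrite ?szw; first [assumption | lia].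
have P1' : compose n.+1 m (compose 2 n mu h) f w
    = compose 2 (m + n).-1 mu (compose n m h f) w + cross 2 n m mu h f w
      + (-1) ^+ (n.+1 * m.+1) *: cross 2 m n mu f h w.
  rewrite [(m + n)%N]addnC.
  by apply: (compose_prelie (l := 2)); rewrite ?szw; first [assumption | lia].
have P2 : compose (m + n).-1 2 (compose m n f h) mu w
    = compose m n.+1 f (compose n 2 h mu) w + cross m n 2 f h mu w
      + (-1) ^+ (n.+1 * 3) *: cross m 2 n f mu h w.
  have := compose_prelie (m := n) (n := 2) h mu (w := w) _ lin_f.
  by rewrite (addn2 n); apply; rewrite // szw addn2.
have P2' : compose m.+1 n (compose m 2 f mu) h w
    = compose m n.+1 f (compose 2 n mu h) w + cross m 2 n f mu h w
      + (-1) ^+ (3 * n.+1) *: cross m n 2 f h mu w.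
  have := compose_prelie (m := 2) (n := n) mu h (w := w) _ lin_f.
  by rewrite (addn2 m); apply; rewrite // szw; lia.
have P3 : compose (m + n).-1 2 (compose n m h f) mu w
    = compose n m.+1 h (compose m 2 f mu) w + cross n m 2 h f mu w
      + (-1) ^+ (m.+1 * 3) *: cross n 2 m h mu f w.
  have := compose_prelie (m := m) (n := 2) f mu (w := w) _ lin_h.
  by rewrite (addn2 m) [(n + m)%N]addnC; apply; rewrite // szw; lia.
have P3' : compose n.+1 m (compose n 2 h mu) f w
    = compose n m.+1 h (compose 2 m mu f) w + cross n 2 m h mu f w
      + (-1) ^+ (3 * m.+1) *: cross n m 2 h f mu w.
  have := compose_prelie (m := 2) (n := m) mu f (w := w) _ lin_h.
  by rewrite (addn2 n); apply; rewrite // szw; lia.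
have -> : circ m n f h = compose m n f h by [].
have -> : circ n m h f = compose n m h f by [].
rewrite P1 P1' P2 P2' P3 P3' prednK //.
(* All signs depend only on the parities of m and n; each of the four cases is an identity in an
   abelian group. *)
have signE e : (-1) ^+ e = if odd e then -1 else 1 :> k.
  by rewrite -signr_odd; case: (odd e); rewrite ?expr0 ?expr1.
rewrite !{}signE !(oddD, oddM) /=.
case: (odd m); case: (odd n); rewrite /= !(scale1r, scaleN1r); zmodule.
Qed.

Lemma multilinear_gbracket m n f h : multilinear m f -> multilinear n h ->
  multilinear (m + n).-1 (gbracket m n f h).
Proof.
move=> lin_f lin_h; apply: multilinearB; first exact: (multilinear_compose
  lin_f lin_h).
by apply: multilinearZ; rewrite addnC; exact: (multilinear_compose lin_h lin_f).
Qed.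

Lemma eq_gbracket m n f f' h h' w : (size w).+1 = (m + n)%N ->
  (forall v, size v = m -> f v = f' v) -> (forall v, size v = n -> h v
    = h' v) ->
  gbracket m n f h w = gbracket m n f' h' w.
Proof.
move=> szw eq_f eq_h; rewrite /gbracket; congr (_ - _ *: _).
  exact: (eq_compose szw eq_f eq_h).
by rewrite addnC in szw; exact: (eq_compose szw eq_h eq_f).
Qed.

Lemma gbracket0r m n f h w : multilinear m f -> (size w).+1 = (m + n)%N ->
  (forall v, size v = n -> h v = 0) -> gbracket m n f h w = 0.
Proof.
move=> lin_f szw h0; rewrite (eq_gbracket (f' := f) (h' := fun=> 0) szw) //.
rewrite /gbracket /circ !big1 ?scaler0 ?subr0 // => i _; rewrite ?scaler0 //.
rewrite (multilinear0 lin_f) ?scaler0 //.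
have lt_im := ltn_ord i; rewrite size_drop size_take; case: ifP; norm_size; lia.
Qed.

Lemma gbracket0l m n f h w : multilinear n h -> (size w).+1 = (m + n)%N ->
  (forall v, size v = m -> f v = 0) -> gbracket m n f h w = 0.
Proof.
move=> lin_h szw f0; rewrite (eq_gbracket (f' := fun=> 0) (h' := h) szw) //.
rewrite /gbracket /circ !big1 ?scaler0 ?subr0 // => i _; rewrite ?scaler0 //.
rewrite (multilinear0 lin_h) ?scaler0 //.
have lt_im := ltn_ord i; rewrite size_drop size_take; case: ifP; norm_size; lia.
Qed.

Lemma gbracketC m n f h w :
  gbracket m n f h w = - (-1) ^+ (m.+1 * n.+1) *: gbracket n m h f w.
Proof.
rewrite /gbracket scaleNr scalerBr scalerA [(n.+1 * m.+1)%N]mulnC -expr2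
  sqrr_sign.
by rewrite scale1r opprB.
Qed.

Lemma HH_cocycle_gbracket m n f h : (0 < m + n)%N ->
  HH_cocycle m f -> HH_cocycle n h -> HH_cocycle (m + n).-1 (gbracket m n f h).
Proof.
move=> mn_gt0 [lin_f df0] [lin_h dh0]; split; first exact: multilinear_gbracket.
move=> w; rewrite prednK // => szw; rewrite HH_diff_gbracket //.
rewrite gbracket0l ?szw // gbracket0r ?szw ?addnS // scaler0 addr0 //.
Qed.

(** If f = d f', the Leibniz rule with d h = 0 exhibits [f, h] as the differential of a signed
    [f', h]. *)
Lemma HH_coboundary_gbracketl m n f h : (0 < m)%N ->
  HH_coboundary m f -> HH_cocycle n h ->
  HH_coboundary (m + n).-1 (gbracket m n f h).
Proof.
case: m => // m _ [f' lin_f' fE] [lin_h dh0]; rewrite addSn /=.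
case: (posnP (m + n)) => [/eqP|mn_gt0].
  (* Here [f', h] would have degree -1, so the Leibniz rule is replaced by a direct check: [f] is an
     inner derivation and [h] a central element, whence f(h) = 0. *)
  rewrite addn_eq0 => /andP[/eqP m0 /eqP n0]; subst m n.
  rewrite /= /gbracket /circ !big_ord_recl !big_ord0 /= scaler0 subr0 addr0.
  have := dh0 [:: f' [::]] erefl.
  rewrite scale1r fE // /bar_diff !big_ord0 /= !addr0 expr1 !scaleN1r.
  by move/eqP; rewrite subr_eq0 => /eqP ->; rewrite subrr.
rewrite -(prednK mn_gt0).
exists (fun w => (-1) ^+ n.+1 *: gbracket m n f' h w).
  exact/multilinearZ/multilinear_gbracket.
move=> w; rewrite prednK // => szw; rewrite (bar_diffZ bimodule_regular).
rewrite HH_diff_gbracket // (gbracket0r (h := d n h)) ?szw ?addnS // addr0.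
rewrite scalerA -expr2 sqrr_sign scale1r; apply: eq_gbracket; rewrite ?szw //.
Qed.

Lemma HH_coboundary_gbracketr m n f h : (0 < n)%N ->
  HH_cocycle m f -> HH_coboundary n h ->
  HH_coboundary (m + n).-1 (gbracket m n f h).
Proof.
move=> n_gt0 cf ch; have := HH_coboundary_gbracketl n_gt0 ch cf.
rewrite /HH_coboundary /coboundary [(n + m)%N]addnC.
case: (m + n).-1 => [|q] /=.
  by rewrite (gbracketC m n) => ->; rewrite scaler0.
case=> u lin_u uE; exists (fun w => - (-1) ^+ (m.+1 * n.+1) *: u w).
  exact: multilinearZ.
by move=> w szw; rewrite (bar_diffZ bimodule_regular) -uE // gbracketC.
Qed.
End Gerstenhaber.

Section LinearHelpers.
Variables (k : fieldType) (U V W : lmodType k).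

Lemma linear_big (I : eqType) (r : seq I) (F : I -> U -> V) :
  (forall i, i \in r -> linear (F i)) -> linear (fun x => \sum_(i <- r) F i x).
Proof.
move=> lin c u v; rewrite scaler_sumr -big_split.
by apply: eq_big_seq => i /lin ->.
Qed.

Lemma linear_comp (f : U -> V) (g : V -> W) :
  linear f -> linear g -> linear (fun x => g (f x)).
Proof. by move=> lin_f lin_g c u v; rewrite lin_f lin_g. Qed.

End LinearHelpers.

Lemma linear_mull (k : fieldType) (A : algType k) (a : A) : linear (fun x => a
  * x).
Proof. by move=> c u v; rewrite mulrDr scalerAr. Qed.

Lemma linear_mulr (k : fieldType) (A : algType k) (a : A) : linear (fun x => x
  * a).
Proof. by move=> c u v; rewrite mulrDl scalerAl. Qed.

(** * Sweedler calculus and the Eckmann-Shapiro isomorphism on cochains *)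

Section Sweedler.
Variables (k : fieldType) (A : algType k) (delta : A -> seq (A * A)).
Variables (eps : {lrmorphism A -> k^o}) (S : {linear A -> A}).
Hypothesis hopfA : is_hopf delta eps S.

(** Equality of tensors is defined by testing on multilinear maps; this form lets a Hopf axiom be
    applied under any bilinear expression. *)
Lemma tensor2_sum (M : lmodType k) (s t : seq (A * A)) (Phi : A -> A -> M) :
  tensor2_eq s t -> (forall a, linear (Phi a))
    -> (forall b, linear (Phi^~ b)) ->
  \sum_(u <- s) Phi u.1 u.2 = \sum_(u <- t) Phi u.1 u.2.
Proof.
move=> eq_st linr linl.
have := eq_st M (fun w => Phi w`_0 w`_1); rewrite !big_map; apply.
by move=> [|a [|b s']] [|a' [|b' t']] //= _ c u v; rewrite ?linl ?linr.
Qed.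

Lemma delta_linear_sum (M : lmodType k) (Phi : A -> A -> M) :
  (forall a, linear (Phi a)) -> (forall b, linear (Phi^~ b)) ->
  linear (fun a => \sum_(u <- delta a) Phi u.1 u.2).
Proof.
move=> linr linl c a b.
rewrite (tensor2_sum (hopf_delta_linear hopfA c a b)) // big_cat big_map /=.
congr (_ + _); rewrite scaler_sumr; apply: eq_bigr => u _.
have := linl u.2 (-1) 0 0; rewrite scaler0 addr0 scaleN1r addNr => Phi0.
by have := linl u.2 c u.1 0; rewrite Phi0 !addr0.
Qed.

Lemma delta1_sum (M : lmodType k) (Phi : A -> A -> M) :
  (forall a, linear (Phi a)) -> (forall b, linear (Phi^~ b)) ->
  \sum_(u <- delta 1) Phi u.1 u.2 = Phi 1 1.
Proof.
by move=> *; rewrite (tensor2_sum (hopf_delta1 hopfA)) // big_seq1.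
Qed.

Lemma deltaM_sum (M : lmodType k) (Phi : A -> A -> M) a b :
  (forall a, linear (Phi a)) -> (forall b, linear (Phi^~ b)) ->
  \sum_(u <- delta (a * b)) Phi u.1 u.2
  = \sum_(u <- delta a) \sum_(v <- delta b) Phi (u.1 * v.1) (u.2 * v.2).
Proof.
by move=> *; rewrite (tensor2_sum (hopf_deltaM hopfA a b)) // big_allpairs_dep.
Qed.

Lemma coassoc_sum (M : lmodType k) (Phi : A -> A -> A -> M) a :
  (forall x y, linear (Phi x y)) -> (forall x z, linear (fun y => Phi x y z)) ->
  (forall y z, linear (fun x => Phi x y z)) ->
  \sum_(u <- delta a) \sum_(v <- delta u.1) Phi v.1 v.2 u.2
  = \sum_(u <- delta a) \sum_(v <- delta u.2) Phi u.1 v.1 v.2.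
Proof.
move=> lin3 lin2 lin1.
have := hopf_coassoc hopfA a (f := fun w => Phi w`_0 w`_1 w`_2).
rewrite !big_allpairs_dep; apply.
move=> [|x [|y [|z s]]] [|x' [|y' [|z' t]]] //=.
Qed.

Lemma sweedler_cons_sum (M : lmodType k) (Phi : seq A -> A -> M) a w :
  \sum_(v <- sweedler delta (a :: w)) Phi v.1 v.2
  = \sum_(u <- delta a) \sum_(v <- sweedler delta w) Phi (u.1 :: v.1) (u.2 *
    v.2).
Proof. by rewrite /= big_allpairs_dep. Qed.

Lemma sweedler_cat_sum (M : lmodType k) (Phi : seq A -> A -> M) s t :
  \sum_(v <- sweedler delta (s ++ t)) Phi v.1 v.2
  = \sum_(v <- sweedler delta s) \sum_(v' <- sweedler delta t)
      Phi (v.1 ++ v'.1) (v.2 * v'.2).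
Proof.
elim: s Phi => [|a s IH] Phi.
  by rewrite big_seq1 /=; apply: eq_bigr => v _; rewrite mul1r.
rewrite cat_cons !sweedler_cons_sum.
rewrite (sweedler_cons_sum (fun x y => \sum_(v' <- sweedler delta t) Phi (x ++
  v'.1) (y * v'.2))).
apply: eq_bigr => u _; rewrite (IH (fun x y => Phi (u.1 :: x) (u.2 * y))).
by apply: eq_bigr => v _; apply: eq_bigr => v' _; rewrite mulrA.
Qed.

Lemma size_sweedler w v : v \in sweedler delta w -> size v.1 = size w.
Proof.
elim: w v => [|a w IH] v /=; first by rewrite inE => /eqP ->.
by case/allpairsPdep => u [v' [_ /IH <- ->]].
Qed.

Definition multilinear_right (M : lmodType k) n (Phi : seq A -> A
  -> M) : Prop :=
  (forall b, multilinear n (Phi^~ b)) /\ (forall s, size s = n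
    -> linear (Phi s)).

Lemma multilinear_sweedler_sum (M : lmodType k) n (Phi : seq A -> A -> M) :
  multilinear_right n Phi ->
  multilinear n (fun w => \sum_(v <- sweedler delta w) Phi v.1 v.2).
Proof.
move=> [linl linr] s t szst c a b; rewrite !sweedler_cat_sum.
pose Psi (v : seq A * A) x y :=
  \sum_(v' <- sweedler delta t) Phi (v.1 ++ x :: v'.1) (v.2 * (y * v'.2)).
have PsiE e : \sum_(v <- sweedler delta s) \sum_(v' <- sweedler delta (e :: t))
      Phi (v.1 ++ v'.1) (v.2 * v'.2)
    = \sum_(v <- sweedler delta s) \sum_(u <- delta e) Psi v u.1 u.2.
  by apply: eq_bigr => v _; rewrite (sweedler_cons_sum (fun x y => Phi (v.1 ++
    x) (v.2 * y))).
rewrite !PsiE; apply: (linear_big (F := fun v e => \sum_(u <- delta e) Psi v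
  u.1 u.2)) => v /size_sweedler szv.
apply: delta_linear_sum => x; apply: linear_big => v' /size_sweedler szv' d y z.
  rewrite mulrDl mulrDr -scalerAl -scalerAr linr // size_cat /= szv szv' addnS.
  exact: szst.
by rewrite linl // szv szv'.
Qed.

(** [sweedler] is the codiagonal right coaction of the Hopf algebra on its n-th tensor power; this
    is its coassociativity, by coassociativity on the head letter and multiplicativity of the
    coproduct. *)
Lemma sweedler_coassoc_sum (M : lmodType k) n (Phi : seq A -> A -> A -> M) w :
  (forall b c, multilinear n (fun s => Phi s b c)) ->
  (forall s c, size s = n -> linear (fun b => Phi s b c)) ->
  (forall s b, size s = n -> linear (Phi s b)) -> size w = n ->
  \sum_(v <- sweedler delta w) \sum_(v' <- sweedler delta v.1) Phi v'.1 v'.2 v.2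
  = \sum_(v <- sweedler delta w) \sum_(r <- delta v.2) Phi v.1 r.1 r.2.
Proof.
elim: w n Phi => [|a w IH] n Phi lin1 lin2 lin3 szw.
  rewrite /= !big_seq1 /= ?big_seq1 /= delta1_sum // => x; first exact: lin3.
  exact: lin2.
case: n szw lin1 lin2 lin3 => // n [szw] lin1 lin2 lin3.
rewrite (sweedler_cons_sum (fun x y => \sum_(v' <- sweedler delta x) Phi v'.1
  v'.2 y)).
rewrite (sweedler_cons_sum (fun x y => \sum_(r <- delta y) Phi x r.1 r.2)).
pose Psi x y z := \sum_(v <- sweedler delta w) \sum_(r <- delta v.2)
   Phi (x :: v.1) (y * r.1) (z * r.2).
transitivity (\sum_(u <- delta a) \sum_(v <- delta u.1) Psi v.1 v.2 u.2).
  apply: eq_bigr => u _.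
  under eq_bigr => v _ do
    rewrite (sweedler_cons_sum (fun x y => Phi x y (u.2 * v.2))).
  rewrite exchange_big; apply: eq_bigr => u' _.
  apply: (IH n (fun s b c => Phi (u'.1 :: s) (u'.2 * b) (u.2 * c))) => //.
  - move=> b c s t szst; refine (lin1 (u'.2 * b) (u.2 * c) (u'.1 :: s) t _).
    by rewrite /= addSn szst.
  - move=> s c szs; refine (linear_comp (g := fun b => Phi (u'.1 :: s) b (u.2 *
    c)) (linear_mull _) (lin2 _ _ _)).
    by rewrite /= szs.
  move=> s b szs; refine (linear_comp (g := Phi (u'.1 :: s) (u'.2 * b))
    (linear_mull _) (lin3 _ _ _)).
  by rewrite /= szs.
rewrite coassoc_sum.
- apply: eq_bigr => u _; rewrite exchange_big;
  apply: eq_big_seq => v /size_sweedler szv.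
  rewrite deltaM_sum // => x; [apply: lin3|apply: lin2]; by rewrite /= szv szw.
- move=> x y; apply: linear_big => v /size_sweedler szv.
  apply: linear_big => r _; refine (linear_comp (g
    := Phi (x :: v.1) (y * r.1)) (linear_mulr r.2) (lin3 _ _ _)).
  by rewrite /= szv szw.
- move=> x z; apply: linear_big => v /size_sweedler szv.
  apply: linear_big => r _; refine (linear_comp (g
    := fun y => Phi (x :: v.1) y (z * r.2)) (linear_mulr r.1) (lin2 _ _ _)).
  by rewrite /= szv szw.
move=> y z; apply: linear_big => v /size_sweedler szv.
apply: linear_big => r _; refine (lin1 (y * r.1) (z * r.2) [::] v.1 _).
by rewrite /= szv szw.
Qed.

Lemma sweedler_counit_sum (M : lmodType k) n (f : seq A -> M) w :
  multilinear n f -> size w = n ->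
  \sum_(v <- sweedler delta w) (eps v.2 : k) *: f v.1 = f w.
Proof.
elim: w n f => [|a w IH] n f lin_f szw.
  by rewrite /= big_seq1 /= rmorph1 scale1r.
rewrite (sweedler_cons_sum (fun x y => (eps y : k) *: f x)).
case: n szw lin_f => // n [szw] lin_f.
rewrite -{2}(hopf_counitr hopfA a) (multilinear_sum (s
  := [::]) _ _ _ lin_f) ?szw //.
apply: eq_bigr => u _; rewrite -(IH n (fun x => f (u.1 :: x))) //; last first.
  by move=> s t szst; refine (lin_f (u.1 :: s) t _); rewrite /= addSn szst.
by rewrite scaler_sumr; apply: eq_bigr => v _; rewrite rmorphM scalerA.
Qed.

Definition shapiro_inv (phi : seq A -> A) (w : seq A) : A :=
  \sum_(v <- sweedler delta w) phi v.1 * v.2.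

Lemma multilinear_shapiro_inv n phi :
  multilinear n phi -> multilinear n (shapiro_inv phi).
Proof.
move=> lin_phi; apply: (multilinear_sweedler_sum (Phi := fun s b => phi s * b)).
split=> [b|s _]; last exact: linear_mull.
exact: (multilinear_map (linear_mulr b) lin_phi).
Qed.

Lemma eq_shapiro_inv n phi phi' w : (forall v, size v = n -> phi v = phi' v) ->
  size w = n -> shapiro_inv phi w = shapiro_inv phi' w.
Proof.
by move=> eq_phi szw; apply: eq_big_seq => v /size_sweedler szv;
  rewrite eq_phi // szv.
Qed.

Lemma shapiro_invD phi phi' w :
  shapiro_inv (fun v => phi v + phi' v) w = shapiro_inv phi w + shapiro_inv
    phi' w.
Proof. by rewrite -big_split; apply: eq_bigr => v _; rewrite mulrDl. Qed.

(** Coassociativity brings together a factor S(b_1) b_2, which the antipode axiom collapses to the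
    counit. The reverse composite collapses b_1 S(b_2) instead. *)
Lemma shapiro_inv_eckmann_shapiro n f w : multilinear n f -> size w = n ->
  shapiro_inv (eckmann_shapiro delta S f) w = f w.
Proof.
move=> lin_f szw.
have := sweedler_coassoc_sum (Phi := fun s b c => f s * S b * c) (n
  := n) (w := w).
rewrite /shapiro_inv /eckmann_shapiro => coassoc.
under eq_bigr => v _ do rewrite mulr_suml;
  under eq_bigr => v _ do under eq_bigr => v' _ do rewrite mul1r.
rewrite coassoc //.
- rewrite -[RHS](sweedler_counit_sum lin_f szw); apply: eq_bigr => v _.
  under eq_bigr => r _ do rewrite -mulrA.
  by rewrite -mulr_sumr (hopf_antipodel hopfA) mulr_algr.
- move=> b c; apply: multilinear_map (linear_mulr c) _.
  exact: (multilinear_map (linear_mulr (S b)) lin_f).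
- move=> s c _; refine (linear_comp (g := fun x => x * c) _ (linear_mulr c)).
  by move=> e x y; rewrite linearP mulrDr scalerAr.
by move=> s b _; apply: linear_mull.
Qed.

Lemma eckmann_shapiro_shapiro_inv n phi w : multilinear n phi -> size w = n ->
  eckmann_shapiro delta S (shapiro_inv phi) w = phi w.
Proof.
move=> lin_f szw.
have := sweedler_coassoc_sum (Phi := fun s b c => phi s * b * S c) (n
  := n) (w := w).
rewrite /shapiro_inv /eckmann_shapiro => coassoc.
under eq_bigr => v _ do rewrite mul1r mulr_suml.
rewrite coassoc //.
- rewrite -[RHS](sweedler_counit_sum lin_f szw); apply: eq_bigr => v _.
  under eq_bigr => r _ do rewrite -mulrA.
  by rewrite -mulr_sumr (hopf_antipoder hopfA) mulr_algr.
- move=> b c; apply: multilinear_map (linear_mulr (S c)) _.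
  exact: (multilinear_map (linear_mulr b) lin_f).
- move=> s c _; exact: (linear_comp (linear_mull (phi s)) (linear_mulr (S c))).
by move=> s b _ e x y; rewrite linearP mulrDr scalerAr.
Qed.

Lemma eps_antipode a : eps (S a) = eps a.
Proof.
rewrite -{1}(hopf_counitl hopfA a) !linear_sum /=.
have := congr1 eps (hopf_antipoder hopfA a).
rewrite linear_sum linearZ rmorph1 /= => epsE.
rewrite -[RHS]mulr1 -[RHS]epsE; apply: eq_bigr => u _.
by rewrite rmorphM !linearZ.
Qed.

(** Since eps o S = eps, the coacted factor collapses to its counit. Hence [eps_star] of a
    transported cochain can be computed on the Hochschild side. *)
Lemma eps_eckmann_shapiro n f w : multilinear n f -> size w = n ->
  eps (eckmann_shapiro delta S f w) = eps (f w).
Proof.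
move=> lin_f szw; rewrite -(sweedler_counit_sum lin_f szw) !linear_sum /=.
apply: eq_bigr => v _.
by rewrite mul1r rmorphM linearZ /= eps_antipode mulrC.
Qed.

Local Notation dHH := (bar_diff (fun a b : A => a * b) (fun b a : A => b * a)).
Local Notation dad := (bar_diff (ad_act delta S) (fun m a => (eps a : k) *: m)).

Lemma ad_act1 a : ad_act delta S a 1 = (eps a : k)%:A.
Proof.
by rewrite -(hopf_antipoder hopfA); apply: eq_bigr => u _; rewrite mulr1.
Qed.

(** The adjoint action becomes left multiplication after coacting: a_1 m S(a_2) a_3 c = a m c. *)
Lemma ad_act_sum a m c :
  \sum_(u <- delta a) ad_act delta S u.1 m * (u.2 * c) = a * (m * c).
Proof.
under eq_bigr => u _ do rewrite mulr_suml.
rewrite (coassoc_sum (Phi := fun x y z => x * m * S y * (z * c)) a).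
- rewrite -{2}(hopf_counitr hopfA a) mulr_suml; apply: eq_bigr => u _.
  under eq_bigr => v _ do rewrite mulrA -(mulrA (u.1 * m)) -mulrA.
  by rewrite -mulr_sumr -mulr_suml (hopf_antipodel hopfA) mulr_algl -scalerAr
    -scalerAl mulrA.
- by move=> x y; exact: (linear_comp (linear_mulr c) (linear_mull _)).
- move=> x z e y y'.
  by rewrite linearP mulrDr mulrDl -scalerAr -scalerAl.
by move=> y z e x x'; rewrite !mulrDl -!scalerAl.
Qed.

(** The terms match one by one: the left action by [ad_act_sum], the inner products by
    multiplicativity of the coproduct, and the right action by the counit. *)
Lemma shapiro_inv_bar_diff n phi w : multilinear n phi -> size w = n.+1 ->
  dHH n (shapiro_inv phi) w = shapiro_inv (dad n phi) w.
Proof.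
move=> lin_phi szw; rewrite /bar_diff.
have -> : shapiro_inv (dad n phi) w
  = \sum_(v <- sweedler delta w) ad_act delta S v.1`_0 (phi (behead v.1)) * v.2
    + \sum_(i < n) (-1) ^+ i.+1 *: \sum_(v <- sweedler delta w)
         phi (take i v.1 ++ (v.1`_i * v.1`_i.+1) :: drop i.+2 v.1) * v.2
    + (-1) ^+ n.+1 *: \sum_(v <- sweedler delta w)
         ((eps v.1`_n : k) *: phi (take n v.1)) * v.2.
  under [X in _ = _ + X + _]eq_bigr => i _ do rewrite scaler_sumr.
  rewrite exchange_big scaler_sumr -!big_split; apply: eq_bigr => v _ /=.
  rewrite !mulrDl scalerAl; congr (_ + _ + _).
  by rewrite mulr_suml; apply: eq_bigr => i _; rewrite scalerAl.
congr (_ + _ + _); last congr (_ *: _).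
- case: w szw => // a w [szw].
  rewrite (sweedler_cons_sum (fun x y => ad_act delta S x`_0 (phi (behead x)) *
    y)).
  rewrite exchange_big mulr_sumr; apply: eq_bigr => v _.
  by rewrite -ad_act_sum.
- apply: eq_bigr => i _; have lt_in := ltn_ord i; congr (_ *: _).
  have [s [w' [wE szs]]] := @split_at _ i w ltac:(by rewrite szw; lia).
  case: w' wE => [|a [|b t]] wE; try by move: szw; rewrite wE size_cat szs /=;
    lia.
  have -> : take i w ++ w`_i * w`_i.+1 :: drop i.+2 w = s ++ (a * b) :: t.
    rewrite wE !nth_cat szs ltnn subnn take_size_cat // ltnNge leqnSn /= subSnn
      /=.
    by rewrite -addn2 addnC -drop_drop drop_size_cat //= drop0.
  rewrite wE /shapiro_inv (sweedler_cat_sum (fun x y => phi x * y)).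
  rewrite (sweedler_cat_sum (fun x y => phi (take i x ++ x`_i * x`_i.+1 :: drop
    i.+2 x) * y)).
  apply: eq_big_seq => v /size_sweedler szv.
  rewrite (sweedler_cons_sum (fun x y => phi (v.1 ++ x) * (v.2 * y))).
  rewrite (deltaM_sum (Phi := fun x y => \sum_(v' <- sweedler delta t)
      phi (v.1 ++ x :: v'.1) * (v.2 * (y * v'.2)))); last 2 first.
  - move=> x; apply: linear_big => v' _.
    exact: (linear_comp (linear_mulr v'.2) (linear_comp (linear_mull v.2)
      (linear_mull _))).
  - move=> y; apply: linear_big => v' /size_sweedler szv'.
    refine (linear_comp (lin_phi v.1 v'.1 _) (linear_mulr _)).
    by rewrite szv szv'; have := szw; rewrite wE size_cat /= !addnS => -[<-].
  pose Psi x y := phi (take i (v.1 ++ x) ++ (v.1 ++ x)`_i * (v.1 ++ x)`_i.+1 ::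
    drop i.+2 (v.1 ++ x)) * (v.2 * y).
  rewrite (sweedler_cons_sum Psi); apply: eq_bigr => u _.
  rewrite (sweedler_cons_sum (fun x y => Psi (u.1 :: x) (u.2 * y)));
    apply: eq_bigr => u' _.
  apply: eq_bigr => v' _; rewrite /Psi.
  rewrite !nth_cat szv szs ltnn subnn take_size_cat ?szv // ltnNge leqnSn /=
    subSnn /=.
  by rewrite -addn2 addnC -drop_drop drop_size_cat ?szv //= drop0 !mulrA.
case/lastP: w szw => // w b; rewrite size_rcons => -[szw].
rewrite -cats1 (sweedler_cat_sum (fun x y => ((eps x`_n : k) *: phi (take n x))
  * y)).
rewrite take_size_cat // nth_cat szw ltnn subnn (_ : [:: b]`_0
  = b) // /shapiro_inv mulr_suml.
apply: eq_big_seq => v /size_sweedler szv.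
rewrite (sweedler_cons_sum (fun x y => ((eps (v.1 ++ x)`_n : k) *: phi (take n
  (v.1 ++ x))) * (v.2 * y))).
rewrite -{1}(hopf_counitl hopfA b) mulr_sumr; apply: eq_bigr => u _.
rewrite /= big_seq1 /= mulr1 take_size_cat ?szv // nth_cat szv szw ltnn subnn
  /=.
by rewrite -scalerAr -scalerAl mulrA.
Qed.
End Sweedler.

(** * Left modules as bimodules with right action through the counit *)

Record module_action (k : fieldType) (A : algType k) (M : lmodType k)
    (act : A -> M -> M) : Prop := ModuleAction {
  act_linearl : forall m, linear (act^~ m);
  act_linearr : forall a, linear (act a);
  act_mul : forall a b m, act (a * b) m = act a (act b m);
  act1 : forall m, act 1 m = m }.

Lemma bimodule_act (k : fieldType) (A : algType k) (M : lmodType k)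
    (eps : {lrmorphism A -> k^o}) (act : A -> M -> M) :
  module_action act -> bimodule act (fun m a => (eps a : k) *: m).
Proof.
case=> linl linr actM act_1; split=> //.
- by move=> a c u v; rewrite scalerDr !scalerA mulrC.
- by move=> m c u v; rewrite linearP scalerDl scalerA.
- by move=> a b m; rewrite rmorphM scalerA mulrC.
- move=> a b m; have := linr a (-1) 0 0.
  rewrite scaler0 addr0 scaleN1r addNr => act0.
  by have := linr a (eps b) m 0; rewrite act0 !addr0.
by move=> m; rewrite rmorph1 scale1r.
Qed.

Lemma module_action_triv (k : fieldType) (A : algType k)
    (eps : {lrmorphism A -> k^o}) : module_action (triv_act eps).
Proof.
split=> [m c u v|a c u v|a b m|m]; rewrite /triv_act.
- by rewrite linearP mulrDl -scalerAl.
- by rewrite mulrDr -scalerAr.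
- by rewrite rmorphM mulrA.
by rewrite rmorph1 mul1r.
Qed.

(** * The bracket on Hopf algebra cohomology and the parity argument *)

Section HopfBracket.
Variables (k : fieldType) (A : algType k) (delta : A -> seq (A * A)).
Variables (eps : {lrmorphism A -> k^o}) (S : {linear A -> A}).
Hypothesis hopfA : is_hopf delta eps S.

Local Notation dHH := (bar_diff (fun a b : A => a * b) (fun b a : A => b * a)).
Local Notation dad := (bar_diff (ad_act delta S) (fun m a => (eps a : k) *: m)).
Local Notation dtriv :=
  (bar_diff (triv_act eps) (fun (m : k^o) a => (eps a : k) *: m)).

Lemma linear_scalar1 : linear (fun c : k^o => (c : k)%:A : A).
Proof. by move=> c u v; rewrite scalerDl scalerA. Qed.

Lemma bar_diff_eta_star n alpha w :
  dad n (eta_star alpha) w = (dtriv n alpha w : k)%:A.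
Proof.
apply: (bar_diff_map (phi := fun c : k^o => (c : k)%:A : A)).
- exact: linear_scalar1.
- move=> a c; rewrite /triv_act mulrC -scalerA -(ad_act1 hopfA) scaler_sumr.
  by apply: eq_bigr => u _; rewrite -scalerAr -scalerAl.
by move=> a c; rewrite scalerA.
Qed.

Lemma multilinear_eta_star n alpha : multilinear n alpha
  -> multilinear n (eta_star alpha : seq A -> A).
Proof. exact: multilinear_map linear_scalar1. Qed.

(** [shapiro_inv] provides a lift that maps to [eta_star alpha] on the nose. *)
Lemma es_lift_exists n alpha : ext_cocycle eps (triv_act eps) n alpha ->
  exists f, es_lift delta eps S n (eta_star alpha) f.
Proof.
move=> [lin_a da0]; have lin_ea := multilinear_eta_star lin_a.
exists (shapiro_inv delta (eta_star alpha)); split.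
  split; first exact (multilinear_shapiro_inv hopfA lin_ea).
  move=> w szw; rewrite (shapiro_inv_bar_diff hopfA) //.
  rewrite (eq_shapiro_inv delta (phi' := fun=> 0) _ szw); last first.
    by move=> v szv; rewrite bar_diff_eta_star da0 // scale0r.
  by rewrite /shapiro_inv big1 // => v _; rewrite mul0r.
case: n lin_ea {lin_a da0} => [|n] lin_ea /=.
  by rewrite (eckmann_shapiro_shapiro_inv hopfA lin_ea) // subrr.
exists (fun=> 0); first exact: multilinear_const0.
move=> w szw; rewrite (eckmann_shapiro_shapiro_inv hopfA lin_ea) // subrr.
rewrite /bar_diff !scaler0 addr0 [X in _ + X]big1 ?addr0; last first.
  by move=> i _; rewrite scaler0.
by rewrite /ad_act big1 // => u _; rewrite mulr0 mul0r.
Qed.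

(** Injectivity of the Eckmann-Shapiro map: its value at [f] is the sum of two coboundaries, and
    [shapiro_inv] pulls both primitives back. *)
Lemma es_lift_coboundary n alpha f : (0 < n)%N ->
  ext_coboundary eps (triv_act eps) n alpha ->
  es_lift delta eps S n (eta_star alpha) f -> HH_coboundary n f.
Proof.
case: n => // n _ [alpha' lin_a' aE] [[lin_f _] [phi lin_phi phiE]].
have lin_ea' := multilinear_eta_star lin_a'.
exists (fun w => shapiro_inv delta phi w + shapiro_inv delta (eta_star alpha')
  w).
  by apply: multilinearD; apply: (multilinear_shapiro_inv hopfA).
move=> w szw; rewrite (bar_diffD (bimodule_regular A)).
rewrite !(shapiro_inv_bar_diff hopfA) // -shapiro_invD.
rewrite -(shapiro_inv_eckmann_shapiro hopfA lin_f szw).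
apply: (eq_shapiro_inv delta _ szw) => v szv.
by rewrite -phiE // bar_diff_eta_star -aE // subrK.
Qed.

(** [eps] is an algebra map to the commutative field, hence a bimodule map onto the trivial
    coefficients. *)
Lemma bar_diff_eps n f w : dtriv n (fun v => eps (f v)) w = eps (dHH n f w).
Proof.
apply: (bar_diff_map (phi := eps)).
- by move=> c u v; rewrite linearP.
- by move=> a b; rewrite rmorphM.
by move=> b a; rewrite rmorphM mulrC.
Qed.

Lemma ext_cocycle_eps n f : HH_cocycle n f ->
  ext_cocycle eps (triv_act eps) n (fun v => eps (f v)).
Proof.
move=> [lin_f df0]; split.
  by apply: (multilinear_map (phi := eps)) => // c u v; rewrite linearP.
by move=> w szw; rewrite bar_diff_eps df0 // linear0.
Qed.

Lemma ext_coboundary_eps n f : HH_coboundary n f ->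
  ext_coboundary eps (triv_act eps) n (fun v => eps (f v)).
Proof.
case: n => [|n] /=; first by move=> ->; rewrite linear0.
case=> h lin_h hE; exists (fun v => eps (h v)).
  by apply: (multilinear_map (phi := eps)) => // c u v; rewrite linearP.
by move=> w szw; rewrite bar_diff_eps -hE.
Qed.

Lemma ext_coboundary_eps_star n f gamma : multilinear n f ->
  ext_coboundary eps (triv_act eps) n (fun v => eps (f v)) ->
  ext_cohomologous eps (triv_act eps) n gamma
    (eps_star eps (eckmann_shapiro delta S f)) ->
  ext_coboundary eps (triv_act eps) n gamma.
Proof.
move=> lin_f; case: n lin_f => [|n] lin_f.
  by rewrite /= /eps_star (eps_eckmann_shapiro hopfA lin_f) // => ->;
    rewrite subr0.
move=> [u lin_u uE] [v lin_v vE]; exists (fun w => u w + v w).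
  exact: multilinearD.
move=> w szw; rewrite (bar_diffD (bimodule_act eps (module_action_triv eps))).
by rewrite -uE // -vE // /eps_star (eps_eckmann_shapiro hopfA lin_f) // addrC
  subrK.
Qed.

(** If m + n is even and positive, the bracket is a cocycle of odd degree. If m + n is odd, an
    argument of odd degree is a coboundary, hence so is its lift and the bracket. The claim covers
    every choice of lifts [f], [h] and representative [gamma]. *)
Lemma hopf_bracket_odd_vanishing :
  (forall n alpha, odd n -> ext_cocycle eps (triv_act eps) n alpha ->
     ext_coboundary eps (triv_act eps) n alpha) ->
  forall m n alpha beta,
    ext_cocycle eps (triv_act eps) m alpha ->
    ext_cocycle eps (triv_act eps) n beta ->
    (exists gamma, is_hopf_bracket delta eps S m n alpha beta gamma) /\
    (forall gamma, is_hopf_bracket delta eps S m n alpha beta gamma ->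
       ext_coboundary eps (triv_act eps) (m + n).-1 gamma).
Proof.
move=> Hodd m n alpha beta ca cb; split.
  have [f fP] := es_lift_exists ca; have [h hP] := es_lift_exists cb.
  exists (eps_star eps (eckmann_shapiro delta S (gbracket m n f h))), f, h.
  split=> //; rewrite /ext_cohomologous /cohomologous.
  case: (m + n).-1 => [|q] /=; first by rewrite subrr.
  exists (fun=> 0); first exact: multilinear_const0.
  by move=> w _; rewrite subrr (bar_diff0 (bimodule_act eps (module_action_triv
    eps))).
move=> gamma [f [h [fP hP]]].
have [[cf _] [ch _]] := (fP, hP).
apply: ext_coboundary_eps_star.
  exact: (multilinear_gbracket cf.1 ch.1).
have [mn0|mn_gt0] := posnP (m + n).
  have [m0 n0] : m = 0%N /\ n = 0%N by lia.
  subst m n; rewrite /= /gbracket /circ !big_ord0 scaler0 subr0.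
  exact: linear0.
have [oddmn|evenmn] := boolP (odd (m + n)); last first.
  apply: (Hodd _ _ _ (ext_cocycle_eps (HH_cocycle_gbracket mn_gt0 cf ch))).
  by move: evenmn; rewrite -{1}(prednK mn_gt0) /= negbK.
apply: ext_coboundary_eps; move: oddmn; rewrite oddD.
have [oddm|evenm] := boolP (odd m) => [_|oddn].
  have m_gt0 : (0 < m)%N by case: (m) oddm.
  exact: (HH_coboundary_gbracketl m_gt0 (es_lift_coboundary m_gt0 (Hodd _ _
    oddm ca) fP)).
have n_gt0 : (0 < n)%N by case: (n) oddn.
exact: (HH_coboundary_gbracketr n_gt0 cf (es_lift_coboundary n_gt0 (Hodd _ _
  oddn cb) hP)).
Qed.
End HopfBracket.

(** * Generation of the Taft algebra by g and x *)

Section SubalgebraType.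
Variables (k : fieldType) (T : algType k) (P : {pred T}).
Hypothesis closedP : GRing.subalg_closed P.

(** The closure proof is an argument so that the algebra structure can be inferred from the
    predicate itself. *)
Definition closed_pred of GRing.subalg_closed P : {pred T} := P.
HB.instance Definition _ :=
  GRing.isSubalgClosed.Build k T (closed_pred closedP) closedP.

Record subalgebra := Subalgebra { subalgebra_val : T;
                                  _ : subalgebra_val \in closed_pred closedP }.
HB.instance Definition _ := [isSub for subalgebra_val].
HB.instance Definition _ := [Choice of subalgebra by <:].
HB.instance Definition _ := [SubChoice_isSubAlgebra of subalgebra by <:].

Lemma subalgebra_val_scalable : scalable (val : subalgebra -> T).
Proof. by move=> c u; rewrite linearZ. Qed.

Definition subalgebra_incl : {lrmorphism subalgebra -> T} :=
  HB.pack_for {lrmorphism subalgebra -> T} (val : subalgebra -> T)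
    (GRing.RMorphism.on (val : subalgebra -> T))
    (GRing.isScalable.Build k subalgebra T *:%R (val : subalgebra -> T)
       subalgebra_val_scalable).

End SubalgebraType.

Section Generated.
Variables (k : fieldType) (p : nat) (omega : k) (T : algType k) (g x : T).
Hypothesis taftT : is_taft_algebra p omega g x.

(** The universal property maps [T] into the subalgebra; followed by the inclusion, this map fixes g
    and x, so by uniqueness it is the identity. *)
Lemma taft_generated (P : {pred T}) : GRing.subalg_closed P ->
  g \in P -> x \in P -> forall a, a \in P.
Proof.
move=> closedP gP xP a.
pose g' : subalgebra closedP := Subalgebra gP.
pose x' : subalgebra closedP := Subalgebra xP.
pose iota := subalgebra_incl closedP.
have [phi [phig phix _]] : exists phi : {lrmorphism T -> subalgebra closedP},
   [/\ phi g = g', phi x = x' & forall psi : {lrmorphism T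
     -> subalgebra closedP},
            psi g = g' -> psi x = x' -> psi =1 phi].
  have [[gp1 xp0 xg] univ] := taftT; apply: univ; split; apply: val_inj.
  - by rewrite rmorphXn rmorph1.
  - by rewrite rmorphXn rmorph0.
  by rewrite linearZ !rmorphM.
have [psi [_ _ psi_uniq]] := taftT.2 T g x taftT.1.
have phiK b : val (phi b) = b.
  have -> : val (phi b) = psi b.
    by apply: (psi_uniq (iota \o phi)); rewrite /= ?phig ?phix.
  by rewrite -(psi_uniq idfun).
by rewrite -(phiK a); apply: valP.
Qed.
End Generated.

(** * Matrix representations of the Taft algebra *)

Section TaftModules.
Variables (k : fieldType) (q : nat) (omega : k).
Local Notation p := q.+1.
Hypothesis prim_omega : p.-primitive_root omega.

(* The module I_c of sequences v with (g v)_j = omega^(c + j) v_j and         *)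
(* (x v)_j = v_{j+1}; it is coinduced from the character g |-> omega^c of     *)
(* <g>: v_j is the value at x^j.                                              *)
Definition taft_g (c : nat) : 'M[k]_p :=
  \matrix_(i, j) ((i == j)%:R * omega ^+ (c + i)).
Definition taft_x : 'M[k]_p := \matrix_(i, j) ((j == i.+1 :> nat)%:R).

Lemma taft_gX c n i j :
  (taft_g c ^+ n) i j = (i == j)%:R * omega ^+ (n * (c + i)).
Proof.
elim: n j => [|n IH] j; first by rewrite expr0 !mxE mulr1.
rewrite exprSr !mxE (bigD1 i) //= big1 ?addr0 => [|l /negPf neq_li]; last first.
  by rewrite IH eq_sym neq_li !mul0r.
by rewrite IH eqxx mul1r mxE mulrCA -exprD -mulSnr.
Qed.

Lemma taft_xX n i j : (taft_x ^+ n) i j = (j == (i + n)%N :> nat)%:R.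
Proof.
elim: n j => [|n IH] j; first by rewrite expr0 !mxE addn0 eq_sym.
rewrite exprSr !mxE; have [lt_in|le_in] := ltnP (i + n) p.
  rewrite (bigD1 (Ordinal lt_in)) //= big1 ?addr0 => [|l].
    by rewrite IH eqxx mul1r mxE /= addnS.
  by rewrite -val_eqE /= => /negPf neq_l; rewrite IH neq_l mul0r.
rewrite big1 => [|l _]; last first.
  by rewrite IH (ltn_eqF (leq_trans (ltn_ord l) le_in)) mul0r.
by rewrite addnS ltn_eqF // ltnS; apply: leq_trans le_in; apply: ltnW.
Qed.

Lemma taft_relations_mx c : taft_relations p omega (taft_g c) taft_x.
Proof.
split.
- apply/matrixP => i j; rewrite taft_gX mxE exprM.
  by rewrite (prim_expr_order prim_omega) expr1n mulr1.
- apply/matrixP => i j; rewrite taft_xX mxE ltn_eqF //.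
  exact: leq_trans (ltn_ord j) (leq_addl _ _).
apply/matrixP => i j; rewrite !mxE.
rewrite (bigD1 j) //= big1 ?addr0 => [|l /negPf neq_l]; last first.
  by rewrite !mxE neq_l mul0r mulr0.
rewrite (bigD1 i) //= big1 ?addr0 => [|l /negPf neq_l]; last first.
  by rewrite !mxE eq_sym neq_l !mul0r.
rewrite !mxE !eqxx !mul1r.
case: eqP => [-> |_]; last by rewrite mul0r !mulr0.
by rewrite addnS exprS mul1r mulr1.
Qed.

Lemma taft_gxX c a b i j :
  (taft_g c ^+ a * taft_x ^+ b) i j
  = omega ^+ (a * (c + i)) * (j == (i + b)%N :> nat)%:R.
Proof.
rewrite !mxE (bigD1 i) //= big1 ?addr0 => [|l /negPf neq_l]; last first.
  by rewrite taft_gX eq_sym neq_l !mul0r.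
by rewrite taft_gX taft_xX eqxx mul1r.
Qed.

Lemma omega_neq0 : omega != 0.
Proof.
apply/eqP => omega0; have := prim_expr_order prim_omega.
by move/eqP; rewrite omega0 expr0n /= eq_sym oner_eq0.
Qed.

(** Orthogonality of the characters of the cyclic group of order p, by summing a geometric
    progression. *)
Lemma prim_root_sum (a b : 'I_p) :
  \sum_(c < p) (omega ^+ (c * a))^-1 * omega ^+ (b * c) = ((b == a) * p)%:R.
Proof.
pose z := (omega ^+ a)^-1 * omega ^+ b.
under eq_bigr => c _ do rewrite mulnC !exprM -exprVn -exprMn -/z.
have [eq_ba|neq_ab] := eqVneq b a.
  rewrite mul1n (_ : z = 1); last by rewrite /z eq_ba mulVf ?expf_neq0
    ?omega_neq0.
  under eq_bigr => c _ do rewrite expr1n.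
  by rewrite sumr_const card_ord.
rewrite mul0n; have z1 : z != 1.
  apply: contra neq_ab => /eqP z1; rewrite -val_eqE /=.
  have : omega ^+ b = omega ^+ a.
    by rewrite -[LHS](mulVKf (expf_neq0 a omega_neq0)) -/z z1 mulr1.
  by move/eqP; rewrite (eq_prim_root_expr prim_omega) !modn_small.
apply: (mulfI (x := z - 1)); first by rewrite subr_eq0.
rewrite mulr0 -subrX1 /z exprMn exprVn -!exprM ![(_ * p)%N]mulnC !exprM.
by rewrite (prim_expr_order prim_omega) !expr1n invr1 mulr1 subrr.
Qed.
End TaftModules.

(** * The monomial basis of the Taft algebra *)

Section TaftBasis.
Variables (k : fieldType) (q : nat) (omega : k).
Local Notation p := q.+1.
Hypothesis prim_omega : p.-primitive_root omega.
Hypothesis p_neq0 : p%:R != 0 :> k.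
Variables (T : algType k) (g x : T).
Hypothesis taftT : is_taft_algebra p omega g x.

Lemma taft_representation c : exists rho : {lrmorphism T -> 'M[k]_p},
  rho g = taft_g q omega c /\ rho x = taft_x k q.
Proof.
have [_ univ] := taftT.
have [rho [rho_g rho_x _]] := univ _ _ _ (taft_relations_mx prim_omega c).
by exists rho.
Qed.

Definition taft_monomial (i j : nat) : T := g ^+ i * x ^+ j.
Local Notation e := taft_monomial.

Lemma taft_monomialDp i j : e (i + p) j = e i j.
Proof. by have [[gp _ _] _] := taftT; rewrite /e exprD gp mulr1. Qed.

Lemma taft_monomial_mod i j : e (i %% p)%N j = e i j.
Proof.
have [[gp _ _] _] := taftT.
by rewrite {2}(divn_eq i p) /e exprD mulnC exprM gp expr1n mul1r.
Qed.

Lemma taft_monomial0 i j : (p <= j)%N -> e i j = 0.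
Proof.
have [[_ xp _] _] := taftT => le_pj.
by rewrite /e -(subnK le_pj) exprD xp !mulr0.
Qed.

Lemma taft_commutation b c : x ^+ b * g ^+ c = omega ^+ (b * c) *: (g ^+ c * x
  ^+ b).
Proof.
have [[_ _ xg] _] := taftT.
have xgc : x * g ^+ c = omega ^+ c *: (g ^+ c * x).
  elim: c => [|c IH]; first by rewrite !expr0 scale1r mul1r mulr1.
  rewrite exprS mulrA xg -scalerAl -!(mulrA g) IH -scalerAr scalerA.
  by rewrite -exprS.
elim: b => [|b IH]; first by rewrite mul0n !expr0 scale1r mul1r mulr1.
rewrite exprS -mulrA IH -scalerAr (mulrA x) xgc -scalerAl scalerA -!(mulrA (g
  ^+ c)).
by rewrite -exprD mulSn addnC.
Qed.

Lemma taft_monomialM i j l m : e i j * e l m = omega ^+ (j * l) *: e (i + l) (j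
  + m).
Proof.
rewrite /e -mulrA (mulrA (x ^+ j)) taft_commutation -scalerAl -scalerAr.
by rewrite -mulrA -exprD !mulrA -exprD.
Qed.

(** The top row of g^a x^b acting on I_c is omega^(a c) in column b and zero elsewhere. Fourier
    inversion over c isolates the exponent a modulo p. *)
Lemma taft_coef_exists : exists coef : 'I_p -> 'I_p -> T -> k^o,
  (forall i j, linear (coef i j)) /\
  forall (i j : 'I_p) a b, coef i j (e a b) = ((i == (a %% p)%N :> nat) && (j
    == b :> nat))%:R.
Proof.
have /fin_all_exists[rho rhoP] (c : 'I_p) := taft_representation c.
exists (fun i j a => p%:R^-1 * \sum_(c < p) (omega ^+ (c * i))^-1 * rho c a 0
  j).
split=> [i j c u v|i j a b].
  have scaleE (d y : k) : d *: (y : k^o) = d * y by [].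
  rewrite scaleE mulrCA -mulrDr; congr (_ * _).
  rewrite mulr_sumr -big_split; apply: eq_bigr => l _.
  by rewrite linearP !mxE mulrDr mulrCA.
rewrite -taft_monomial_mod /e.
have lt_ap : (a %% p < p)%N by rewrite ltn_mod.
have rhoE c : rho c (g ^+ (a %% p)%N * x ^+ b) 0 j
    = omega ^+ ((a %% p)%N * c) * (j == b :> nat)%:R.
  by rewrite rmorphM !rmorphXn /= (rhoP c).1 (rhoP c).2 taft_gxX addn0 add0n.
under eq_bigr => c _ do rewrite rhoE mulrA.
rewrite -mulr_suml (prim_root_sum prim_omega i (Ordinal lt_ap)) -val_eqE /=.
by rewrite natrM mulrA mulrCA mulVf // mulr1 -natrM mulnb eq_sym.
Qed.

(** Periodicity in i and vanishing for j >= p are the relations that the monomials satisfy; under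
    them the values of [F] at reduced exponents determine all the others. *)
Lemma taft_coef_sum (M : lmodType k) (coef : 'I_p -> 'I_p -> T
  -> k^o) (F : nat -> nat -> M) a b :
  (forall (i j : 'I_p) a b, coef i j (e a b) = ((i == (a %% p)%N :> nat) && (j
    == b :> nat))%:R) ->
  (forall i j, F (i + p)%N j = F i j) -> (forall i j, (p <= j)%N -> F i j
    = 0) ->
  \sum_i \sum_j (coef i j (e a b) : k) *: F i j = F a b.
Proof.
move=> coefE FDp F0; have lt_ap : (a %% p < p)%N by rewrite ltn_mod.
have -> : F a b = F (a %% p)%N b.
  rewrite {1}(divn_eq a p) addnC; elim: (a %/ p)%N => [|n IH].
    by rewrite mul0n addn0.
  by rewrite mulSnr addnA FDp.
rewrite (bigD1 (Ordinal lt_ap)) //= [X in _ + X]big1 ?addr0 => [|i]; last first.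
  rewrite -val_eqE /= => /negPf neq_i; rewrite big1 // => j _.
  by rewrite coefE neq_i scale0r.
have [lt_bp|le_pb] := ltnP b p; last first.
  rewrite F0 // big1 // => j _; rewrite coefE andbC ltn_eqF ?scale0r //.
  exact: leq_trans (ltn_ord j) le_pb.
rewrite (bigD1 (Ordinal lt_bp)) //= big1 ?addr0 => [|j].
  by rewrite coefE !eqxx scale1r.
by rewrite -val_eqE /= => /negPf neq_j; rewrite coefE neq_j andbF scale0r.
Qed.

Lemma taft_basis : exists coef : 'I_p -> 'I_p -> T -> k^o,
  [/\ forall i j, linear (coef i j),
      forall (i j : 'I_p) a b,
        coef i j (e a b) = ((i == (a %% p)%N :> nat) && (j == b :> nat))%:R &
      forall a, \sum_i \sum_j (coef i j a : k) *: e i j = a].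
Proof.
have [coef [lin_coef coefE]] := taft_coef_exists.
exists coef; split=> //.
pose r a := \sum_i \sum_j (coef i j a : k) *: e i j.
have lin_r : linear r.
  move=> c u v; rewrite /r scaler_sumr -big_split; apply: eq_bigr => i _.
  rewrite scaler_sumr -big_split; apply: eq_bigr => j _ /=.
  by rewrite lin_coef scalerDl scalerA.
have r0 : r 0 = 0 by have := lin_r (-1) 0 0;
  rewrite scaler0 addr0 scaleN1r addNr.
have rD y z : r (y + z) = r y + r z by have := lin_r 1 y z; rewrite !scale1r.
have rZ c y : r (c *: y) = c *: r y by have := lin_r c y 0; rewrite r0 !addr0.
have r_e i j : r (e i j) = e i j.
  exact: taft_coef_sum coefE taft_monomialDp taft_monomial0.
(* [r] projects onto the span of the monomials, and [P] consists of the elements whose left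
   multiplication preserves that span. Unlike the span itself, this set is visibly closed under
   products. *)
pose P := [pred a | [forall i : 'I_p, forall j : 'I_p, r (a * e i j) == a * e i
  j]].
have PP a : reflect (forall i j : nat, r (a * e i j) = a * e i j) (a \in P).
  apply: (iffP forallP) => [Pa i j|Pa i]; last by apply/forallP => j;
    rewrite Pa.
  rewrite -taft_monomial_mod; have lt_ip : (i %% p < p)%N by rewrite ltn_mod.
  case: (ltnP j p) => [lt_jp|/taft_monomial0 ->]; last first.
    by rewrite mulr0.
  by have /forallP/(_ (Ordinal lt_jp))/eqP := Pa (Ordinal lt_ip).
suff Pall a : a \in P.
  by move=> a; have := PP a (Pall a) 0%N 0%N; rewrite /e !mulr1.
apply: (taft_generated taftT).
- split; first by apply/PP => i j; rewrite mul1r r_e.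
    move=> c u v /PP Pu /PP Pv; apply/PP => i j.
    by rewrite mulrDl -scalerAl lin_r Pu Pv.
  move=> u v /PP Pu /PP Pv; apply/PP => i j.
  rewrite -mulrA -(Pv i j) {2 3}/r mulr_sumr (big_morph r rD r0).
  apply: eq_bigr => l _; rewrite mulr_sumr (big_morph r rD r0).
  by apply: eq_bigr => m _; rewrite -scalerAr rZ Pu.
- apply/PP => i j; rewrite -[g]mulr1 -[g * 1]/(e 1 0).
  by rewrite taft_monomialM rZ r_e.
apply/PP => i j; rewrite -[x]mul1r -[1 * x]/(e 0 1).
by rewrite taft_monomialM rZ r_e.
Qed.

Lemma taft_ind (Q : T -> Prop) :
  (forall c a b, Q a -> Q b -> Q (c *: a + b)) ->
  (forall i j, (j < p)%N -> Q (e i j)) -> forall a, Q a.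
Proof.
move=> Qlin Qe a; have [coef [_ _ /(_ a) <-]] := taft_basis.
have Q0 : Q 0.
  by rewrite -(addNr (e 0 0)) -scaleN1r; apply: Qlin; apply: Qe.
have QD : forall b c, Q b -> Q c -> Q (b + c).
  by move=> b c Qb Qc; rewrite -[b]scale1r; apply: Qlin.
apply: (big_ind Q) => // i _; apply: (big_ind Q) => // j _.
by rewrite -[_ *: _]addr0; apply: Qlin => //; apply: Qe.
Qed.

Lemma taft_linear_exists (M : lmodType k) (F : nat -> nat -> M) :
  (forall i j, F (i + p)%N j = F i j) -> (forall i j, (p <= j)%N -> F i j
    = 0) ->
  exists2 L : T -> M, linear L & forall i j, L (e i j) = F i j.
Proof.
move=> FDp F0; have [coef [lin_coef coefE _]] := taft_basis.
exists (fun a => \sum_i \sum_j (coef i j a : k) *: F i j).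
  move=> c u v; rewrite scaler_sumr -big_split; apply: eq_bigr => i _.
  rewrite scaler_sumr -big_split; apply: eq_bigr => j _ /=.
  by rewrite lin_coef scalerDl scalerA.
by move=> i j; apply: taft_coef_sum.
Qed.

(** Linear extension in the first variable, with values in functions of the basis index of the
    second, followed by extension in the second. *)
Lemma taft_bilinear_exists (M : lmodType k) (F : nat -> nat -> nat -> nat
  -> M) :
  (forall i j l m, F (i + p)%N j l m = F i j l m) ->
  (forall i j l m, (p <= j)%N -> F i j l m = 0) ->
  (forall i j l m, F i j (l + p)%N m = F i j l m) ->
  (forall i j l m, (p <= m)%N -> F i j l m = 0) ->
  exists L : T -> T -> M, [/\ forall a, linear (L a), forall b, linear (L^~ b) &
    forall i j l m, L (e i j) (e l m) = F i j l m].
Proof.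
move=> F1 F10 F2 F20.
pose F' i j : {ffun 'I_p * 'I_p -> M} := [ffun u : 'I_p * 'I_p => F i j u.1
  u.2].
have [i j|i j le_pj|L1 lin_L1 L1E] := @taft_linear_exists _ F'.
- by apply/ffunP => u; rewrite !ffunE F1.
- by apply/ffunP => u; rewrite !ffunE F10.
have [coef [lin_coef coefE _]] := taft_basis.
exists (fun a b => \sum_l \sum_m (coef l m b : k) *: L1 a (l, m)); split.
- move=> a c u v; rewrite scaler_sumr -big_split; apply: eq_bigr => i _.
  rewrite scaler_sumr -big_split; apply: eq_bigr => j _ /=.
  by rewrite lin_coef scalerDl scalerA.
- move=> b c u v; rewrite scaler_sumr -big_split; apply: eq_bigr => i _.
  rewrite scaler_sumr -big_split; apply: eq_bigr => j _ /=.
  by rewrite lin_L1 !ffunE scalerDr !scalerA mulrC.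
move=> i j l m; rewrite -(taft_coef_sum l m coefE (F2 i j) (F20 i j)).
apply: eq_bigr => l' _; apply: eq_bigr => m' _.
by rewrite L1E ffunE.
Qed.
End TaftBasis.

(** * A nonzero Gerstenhaber bracket in Hochschild cohomology *)

Section TaftHochschild.
Variables (k : fieldType) (q : nat) (omega : k).
Local Notation p := q.+1.
Hypothesis q_gt0 : (0 < q)%N.
Hypothesis prim_omega : p.-primitive_root omega.
Hypothesis p_neq0 : p%:R != 0 :> k.
Variables (T : algType k) (g x : T).
Hypothesis taftT : is_taft_algebra p omega g x.
Local Notation e := (taft_monomial g x).
Let eM := taft_monomialM taftT.
Let e0 := taft_monomial0 taftT.
Let eDp := taft_monomialDp taftT.

Lemma taft_euler_derivation : exists D : T -> T,
  [/\ linear D, forall a b, D (a * b) = a * D b + D a * b &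
      forall i j, D (e i j) = j%:R *: e i j].
Proof.
have [i j|i j /e0 ->|D lin_D DE] :=
    @taft_linear_exists _ _ _ prim_omega p_neq0 _ _ _ taftT _ (fun i j => j%:R
      *: e i j).
- by rewrite eDp.
- by rewrite scaler0.
exists D; split=> // a b; move: a b.
apply: (taft_ind prim_omega p_neq0 taftT) => [c a a' IHa IHa' b|i j _ b].
  rewrite mulrDl -scalerAl !lin_D IHa IHa' !mulrDl -!scalerAl scalerDr.
  by rewrite -!addrA; congr (_ + _); rewrite addrCA.
move: b; apply: (taft_ind prim_omega p_neq0 taftT) => [c b b' IHb IHb'|l m _].
  rewrite mulrDr -scalerAr !lin_D IHb IHb' !mulrDr -!scalerAr scalerDr.
  by rewrite -!addrA; congr (_ + _); rewrite addrCA.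
have D0 : D 0 = 0 by have := lin_D (-1) 0 0;
  rewrite scaler0 addr0 scaleN1r addNr.
have DZ c y : D (c *: y) = c *: D y by have := lin_D c y 0; rewrite D0 !addr0.
rewrite eM DZ !DE -scalerAl -scalerAr eM !scalerA -scalerDl natrD.
by rewrite mulrDr addrC ![omega ^+ _ * _]mulrC.
Qed.

(* The infinitesimal deformation of the relation x^p = 0 into x^p = t.        *)
Definition taft_cocycle_value (i j l m : nat) : T :=
  if (j < p)%N && (m < p)%N && (p <= j + m)%N
  then omega ^+ (j * l) *: e (i + l) (j + m - p) else 0.

(** The cocycle identity is associativity of the deformed product modulo t^2; by trilinearity it is
    checked on monomials. *)
Lemma taft_deformation_cocycle : exists xi : T -> T -> T,
  [/\ forall a, linear (xi a), forall b, linear (xi^~ b),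
      forall i j l m, xi (e i j) (e l m) = taft_cocycle_value i j l m &
      forall a b c, a * xi b c - xi (a * b) c + xi a (b * c) - xi a b * c = 0].
Proof.
have omegap n : omega ^+ (n * p) = 1.
  by rewrite mulnC exprM (prim_expr_order prim_omega) expr1n.
have [i j l m|i j l m le_pj|i j l m|i j l m le_pm|xi [linr linl xiE]] :=
    @taft_bilinear_exists _ _ _ prim_omega p_neq0 _ _ _ taftT _
      taft_cocycle_value.
- by rewrite /taft_cocycle_value addnAC eDp.
- by rewrite /taft_cocycle_value ltnNge le_pj.
- by rewrite /taft_cocycle_value addnA eDp mulnDr exprD omegap mulr1.
- by rewrite /taft_cocycle_value [(m < p)%N]ltnNge le_pm andbF.
exists xi; split=> //.
have xi0r a : xi a 0 = 0 by have := linr a (-1) 0 0;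
  rewrite scaler0 addr0 scaleN1r addNr.
have xi0l b : xi 0 b = 0 by have := linl b (-1) 0 0;
  rewrite /= scaler0 addr0 scaleN1r addNr.
have xiZr a c y : xi a (c *: y) = c *: xi a y by have := linr a c y 0;
  rewrite xi0r !addr0.
have xiZl a c y : xi (c *: y) a = c *: xi y a by have := linl a c y 0;
  rewrite /= xi0l !addr0.
have comb c (s1 s2 s3 s4 t1 t2 t3 t4 : T) : s1 - s2 + s3 - s4 = 0
  -> t1 - t2 + t3 - t4 = 0 ->
    (c *: s1 + t1) - (c *: s2 + t2) + (c *: s3 + t3) - (c *: s4 + t4) = 0.
  move=> s0 t0; transitivity (c *: (s1 - s2 + s3 - s4) + (t1 - t2 + t3 - t4)).
    rewrite !(scalerDr, scalerN).
    by move: (c *: s1) (c *: s2) (c *: s3) (c *: s4) => y1 y2 y3 y4; zmodule.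
  by rewrite s0 t0 scaler0 addr0.
apply: (taft_ind prim_omega p_neq0 taftT) => [c a a' IHa IHa' b d|i j lt_jp b].
  by rewrite !mulrDl -!scalerAl !linl mulrDl -scalerAl comb.
move: b; apply: (taft_ind prim_omega p_neq0 taftT) => [c b b' IHb IHb' d|i1 j1
  lt_j1p d].
  by rewrite !(mulrDl, mulrDr) -!(scalerAl, scalerAr) !linl !linr mulrDr mulrDl
    -scalerAl -scalerAr comb.
move: d; apply: (taft_ind prim_omega p_neq0 taftT) => [c d d' IHd IHd'|i2 j2
  lt_j2p].
  by rewrite !mulrDr -!scalerAr !linr mulrDr -scalerAr comb.
pose W := omega ^+ (j * i1 + j * i2 + j1 * i2).
(* The t-coefficient of a product of three monomials; both bracketings are shown to produce it. *)
pose E := if (p <= j + j1 + j2)%N then W *: e (i + i1 + i2) (j + j1 + j2 - p)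
  else 0.
have T13 : e i j * xi (e i1 j1) (e i2 j2) + xi (e i j) (e i1 j1 * e i2 j2) = E.
  rewrite eM xiZr !xiE /taft_cocycle_value lt_jp lt_j1p lt_j2p /= /E.
  have [le_p12|lt_12p] := leqP p (j1 + j2).
    rewrite scaler0 addr0 (leq_trans le_p12) -?addnA ?leq_addl // -scalerAr eM
      scalerA.
    rewrite /W -exprD addnBA //; congr (omega ^+ _ *: _); lia.
  rewrite mulr0 add0r (addnA j) (addnA i).
  case: (leqP p (j + j1 + j2)%N) => _; last by rewrite scaler0.
  rewrite scalerA -exprD /W; congr (omega ^+ _ *: _); lia.
have T24 : xi (e i j * e i1 j1) (e i2 j2) + xi (e i j) (e i1 j1) * e i2 j2 = E.
  rewrite eM xiZl !xiE /taft_cocycle_value lt_jp lt_j1p lt_j2p /= /E.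
  have [le_p01|lt_01p] := leqP p (j + j1).
    rewrite scaler0 add0r (leq_trans le_p01) ?leq_addr // -scalerAl eM scalerA.
    rewrite /W -exprD addnBAC //.
    (* Moving the extracted x^p past g^i2 costs omega^(p i2) = 1, that is, x^p is central. *)
    have le_pi2 : (p * i2 <= j * i2 + j1 * i2)%N.
      by rewrite -mulnDl leq_mul2r le_p01 orbT.
    rewrite mulnBl mulnDl -(addnA (j * i1)%N) -[in RHS](subnK le_pi2) (addnA (j
      * i1)%N).
    by rewrite [in RHS]exprD [(p * i2)%N]mulnC omegap mulr1.
  rewrite mul0r addr0; case: (leqP p (j + j1 + j2)%N) => _;
    last by rewrite scaler0.
  rewrite scalerA -exprD /W; congr (omega ^+ _ *: _); lia.
have regroup (s1 s2 s3 s4 : T) : s1 - s2 + s3 - s4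
  = s1 + s3 - (s2 + s4) by zmodule.
by rewrite regroup T13 T24 subrr.
Qed.

Lemma taft_HH_bracket_nonzero (eps : {lrmorphism T -> k^o}) : eps x = 0 ->
  exists (m n : nat) (f h : seq T -> T),
    [/\ HH_cocycle m f, HH_cocycle n h &
        ~ HH_coboundary (m + n).-1 (gbracket m n f h)].
Proof.
move=> eps_x.
have [D [lin_D DM DE]] := taft_euler_derivation.
have [xi [linr linl xiE xi_cocycle]] := taft_deformation_cocycle.
exists 1%N, 2%N, (fun w => D w`_0), (fun w => xi w`_0 w`_1); split.
- split; first by move=> [|a [|b s]] [|c t] //=.
  move=> [|a [|b []]] // _; rewrite /bar_diff big_ord1 /=.
  by rewrite DM expr1 sqrrN expr1n scale1r scaleN1r opprD addrA subrr add0r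
    addNr.
- split; first by move=> [|a [|b [|c s]]] [|a' [|b' t]] //=.
  move=> [|a [|b [|c []]]] // _; rewrite /bar_diff !big_ord_recl big_ord0 /=.
  rewrite addr0 -[RHS](xi_cocycle a b c).
  rewrite (@signr_eq k 3 1) // (@signr_eq k (bump 0 0).+1 0) // expr1 expr0.
  by rewrite scale1r !scaleN1r addrA.
case=> u lin_u uE.
have xE : x = e 0 1 by rewrite /taft_monomial mul1r.
have xqE : x ^+ q = e 0 q by rewrite /taft_monomial mul1r.
have D0 : D 0 = 0 by have := lin_D (-1) 0 0;
  rewrite scaler0 addr0 scaleN1r addNr.
have xi_xq : xi x (x ^+ q) = 1.
  have := xiE 0%N 1%N 0%N q; rewrite -xE -xqE => ->.
  rewrite /taft_cocycle_value add1n !ltnS q_gt0 leqnn /= muln0.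
  by rewrite subnn scale1r /taft_monomial mulr1.
have xiZr a c y : xi a (c *: y) = c *: xi a y.
  have := linr a (-1) 0 0; rewrite scaler0 addr0 scaleN1r addNr => xi0.
  by have := linr a c y 0; rewrite xi0 !addr0.
have D1 : D 1 = 0.
  by rewrite -[1]mulr1 -[1 * 1]/(e 0 0) DE scale0r.
have Dx : D x = x by have := DE 0%N 1%N; rewrite -xE scale1r.
have Dxq : D (x ^+ q) = q%:R *: x ^+ q by have := DE 0%N q; rewrite -xqE.
(* With p = q + 1, the bracket side is D(1) - xi(x, x^q) - q xi(x, x^q) = -p. On the coboundary side
   the middle term contains u(x^p) = 0, and [eps] kills the outer terms since q > 0. *)
have := congr1 eps (uE [:: x; x ^+ q] erefl).
rewrite /gbracket /circ !big_ord_recl !big_ord0 /=.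
rewrite /bump /= xi_xq D1 Dx Dxq xiZr xi_xq.
rewrite /bar_diff big_ord1 /=.
have [[_ xp _] _] := taftT.
rewrite -exprS xp (multilinear0 (s := [::]) lin_u) // !(scaler0, addr0) sub0r.
rewrite (@signr_eq k (2 * 3) 0) // (@signr_eq k (2 * 0) 0) // (@signr_eq k (2 *
  (1 + 0)) 0) //.
rewrite expr0 !scale1r linearN !rmorphD /= !rmorphM rmorphXn /= eps_x.
rewrite mul0r expr0n eqn0Ngt q_gt0 /= mulr0 addr0 rmorph1 linearZ /= rmorph1 =>
  /eqP.
by rewrite oppr_eq0 -[_ *: _]/(q%:R * 1) mulr1 -mulrS (negPf p_neq0).
Qed.
End TaftHochschild.

(** * Dimension shifting along a four-term exact sequence *)

Section DimensionShift.
Variables (k : fieldType) (A : algType k) (eps : {lrmorphism A -> k^o}).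
Variables (K I0 I1 K' : lmodType k).
Variables (actK : A -> K -> K) (act0 : A -> I0 -> I0).
Variables (act1 : A -> I1 -> I1) (actK' : A -> K' -> K').
Hypothesis mod0 : module_action act0.
Hypothesis mod1 : module_action act1.
Variables (iota : {linear K -> I0}) (u : {linear I0
  -> I1}) (pi : {linear I1 -> K'}).
Variables (rho : {linear I0 -> K}) (v : {linear I1
  -> I0}) (sigma : {linear K' -> I1}).
Hypothesis iota_act : forall a m, iota (actK a m) = act0 a (iota m).
Hypothesis u_act : forall a m, u (act0 a m) = act1 a (u m).
Hypothesis pi_act : forall a m, pi (act1 a m) = actK' a (pi m).
Hypothesis iotaK : cancel iota rho.
Hypothesis u_iota : forall m, u (iota m) = 0.
Hypothesis ker_u : forall m, u m = 0 -> m = iota (rho m).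
Hypothesis pi_u : forall m, pi (u m) = 0.
Hypothesis ker_pi : forall m, pi m = 0 -> m = u (v m).
Hypothesis sigmaK : cancel sigma pi.

(** A diagram chase along 0 -> K -> I0 -> I1 -> K' -> 0. The maps [rho], [v] and [sigma] are only
    k-linear; they choose preimages so that corrected cochains stay multilinear. *)
Lemma ext_dimension_shift n :
  (forall f, ext_cocycle eps act0 n.+3 f -> ext_coboundary eps act0 n.+3 f) ->
  (forall f, ext_cocycle eps act1 n.+2 f -> ext_coboundary eps act1 n.+2 f) ->
  (forall f, ext_cocycle eps actK' n.+1 f -> ext_coboundary eps actK' n.+1 f) ->
  forall f, ext_cocycle eps actK n.+3 f -> ext_coboundary eps actK n.+3 f.
Proof.
pose r (M : lmodType k) (m : M) a := (eps a : k) *: m.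
have mapd (M N : lmodType k) (actM : A -> M -> M) (actN : A -> N -> N)
    (phi : {linear M -> N}) : (forall a m, phi (actM a m) = actN a (phi m)) ->
    forall q f w, bar_diff actN (@r N) q (fun t => phi (f t)) w
      = phi (bar_diff actM (@r M) q f w).
  move=> phi_act q f w; apply: bar_diff_map => //; first exact: linearP.
  by move=> a m; rewrite /r linearZ.
have mapl (M N : lmodType k) (phi : {linear M -> N}) q (f : seq A -> M) :
    multilinear q f -> multilinear q (fun t => phi (f t)).
  by apply: multilinear_map; apply: linearP.
have bi0 := bimodule_act eps mod0; have bi1 := bimodule_act eps mod1.
move=> H0 H1 HK' alpha [lin_alpha dalpha0].
have [s lin_s sE] : ext_coboundary eps act0 n.+3 (fun w => iota (alpha w)).
  apply: H0; split; first exact: mapl.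
  by move=> w szw; rewrite (mapd _ _ _ _ _ iota_act) dalpha0 // linear0.
have [t lin_t tE] : ext_coboundary eps act1 n.+2 (fun w => u (s w)).
  apply: H1; split; first exact: mapl.
  by move=> w szw; rewrite (mapd _ _ _ _ _ u_act) -sE // u_iota.
have [b lin_b bE] : ext_coboundary eps actK' n.+1 (fun w => pi (t w)).
  apply: HK'; split; first exact: mapl.
  by move=> w szw; rewrite (mapd _ _ _ _ _ pi_act) -tE // pi_u.
(* Subtracting the differential of [sb] moves [t] into the kernel of [pi], the image of [u], without
   changing its differential. *)
pose sb w := sigma (b w); have lin_sb : multilinear n sb by apply: mapl.
pose t1 w := t w - bar_diff act1 (@r I1) n sb w.
have lin_t1 : multilinear n.+1 t1.
  by apply: multilinearB => //; apply: (multilinear_bar_diff bi1).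
have t1E w : size w = n.+1 -> t1 w = u (v (t1 w)).
  move=> szw; apply: ker_pi; rewrite linearB /= bE // -(mapd _ _ _ _ _ pi_act).
  by apply/eqP; rewrite subr_eq0; apply/eqP; apply: eq_bar_diff szw => w' _;
    rewrite sigmaK.
have dt1 w : size w = n.+2 -> bar_diff act1 (@r I1) n.+1 t1 w = u (s w).
  by move=> szw; rewrite (bar_diffB bi1) (bar_diff_bar_diff bi1) // subr0 tE.
(* Likewise, subtracting the differential of [vt] moves [s] into the kernel of [u], so it comes from
   a cochain in K. *)
pose vt w := v (t1 w); have lin_vt : multilinear n.+1 vt by apply: mapl.
pose s1 w := s w - bar_diff act0 (@r I0) n.+1 vt w.
have lin_s1 : multilinear n.+2 s1.
  by apply: multilinearB => //; apply: (multilinear_bar_diff bi0).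
have s1E w : size w = n.+2 -> s1 w = iota (rho (s1 w)).
  move=> szw; apply: ker_u; rewrite linearB /= -dt1 // -(mapd _ _ _ _ _ u_act).
  by apply/eqP; rewrite subr_eq0; apply/eqP; apply: eq_bar_diff szw => w' /t1E.
exists (fun w => rho (s1 w)); first exact: mapl.
move=> w szw; apply: (can_inj iotaK); rewrite sE // -(mapd _ _ _ _ _ iota_act).
rewrite -[LHS]subr0 -(bar_diff_bar_diff bi0 lin_vt szw) -(bar_diffB bi0).
by apply: eq_bar_diff szw => w' /s1E.
Qed.
End DimensionShift.

Definition linear_pack (k : fieldType) (U V : lmodType k) (f : U -> V)
    (lin_f : linear f) : {linear U -> V} :=
  HB.pack_for {linear U -> V} f (GRing.isLinear.Build k U V *:%R f lin_f).

Lemma periodic_sum (V : zmodType) (p : nat) (F : nat -> V) l :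
  (forall i, F (i + p)%N = F i) -> \sum_(i < p) F (i + l)%N = \sum_(i < p) F i.
Proof.
move=> Fp; elim: l => [|l IH]; first by apply: eq_bigr => i _; rewrite addn0.
rewrite -{}IH; case: p Fp => [|p] Fp; first by rewrite !big_ord0.
rewrite big_ord_recr [RHS]big_ord_recl /= addrC addnS -addSn addnC Fp;
  congr (_ + _).
by apply: eq_bigr => i _; rewrite /bump leq0n add1n addnS addSn.
Qed.

(** * Vanishing of the odd cohomology of the Taft algebra *)

Section TaftVanishing.
Variables (k : fieldType) (q : nat) (omega : k).
Local Notation p := q.+1.
Hypothesis q_gt0 : (0 < q)%N.
Hypothesis prim_omega : p.-primitive_root omega.
Hypothesis p_neq0 : p%:R != 0 :> k.
Variables (T : algType k) (g x : T).
Hypothesis taftT : is_taft_algebra p omega g x.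
Variable eps : {lrmorphism T -> k^o}.
Hypothesis eps_g : eps g = 1.
Hypothesis eps_x : eps x = 0.
Local Notation e := (taft_monomial g x).
Let eM := taft_monomialM taftT.
Let e0 := taft_monomial0 taftT.
Let eDp := taft_monomialDp taftT.

(** Coordinates indexed by all naturals and zero from p on, so that x acts as a shift with no bound
    to carry. *)
Definition coordn (v : 'cV[k]_p) (n : nat) : k
  := \sum_(j < p | j == n :> nat) v j 0.

Lemma coordnE v (j : 'I_p) : coordn v j = v j 0.
Proof. by rewrite /coordn (big_pred1 j). Qed.

Lemma coordn0 v n : (p <= n)%N -> coordn v n = 0.
Proof.
move=> le_pn; rewrite /coordn big_pred0 // => j.
by rewrite ltn_eqF // (leq_trans (ltn_ord j)).
Qed.

Lemma coordn_lt v n (lt_np : (n < p)%N) : coordn v n = v (Ordinal lt_np) 0.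
Proof. by rewrite -(coordnE v (Ordinal lt_np)). Qed.

Lemma taft_gx_mul c a b (v : 'cV[k]_p) j :
  ((taft_g q omega c ^+ a * taft_x k q ^+ b) *m v) j 0
  = omega ^+ (a * (c + j)) * coordn v (j + b).
Proof.
rewrite mxE /coordn mulr_sumr [RHS]big_mkcond; apply: eq_bigr => l _.
rewrite taft_gxX; case: eqP => _; last by rewrite mulr0 mul0r.
by rewrite mulr1.
Qed.

Lemma taft_x_mul (v : 'cV[k]_p) j : (taft_x k q *m v) j 0 = coordn v j.+1.
Proof.
have := taft_gx_mul 0 0 1 v j.
by rewrite expr0 expr1 mul1r mul0n expr0 mul1r addn1.
Qed.

Section Coinduced.
Variables (c : nat) (rho : {lrmorphism T -> 'M[k]_p}).
Hypothesis rho_g : rho g = taft_g q omega c.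
Hypothesis rho_x : rho x = taft_x k q.

Definition coind_act (a : T) (v : 'cV[k]_p) : 'cV[k]_p := rho a *m v.

Lemma coind_actE i j v l : coind_act (e i j) v l 0
  = omega ^+ (i * (c + l)) * coordn v (l + j).
Proof. by rewrite /coind_act rmorphM !rmorphXn /= rho_g rho_x taft_gx_mul. Qed.

Lemma module_action_coind : module_action coind_act.
Proof.
split=> [v d a b|a d u v|a b v|v]; rewrite /coind_act.
- by rewrite linearP mulmxDl -scalemxAl.
- by rewrite mulmxDr -scalemxAr.
- by rewrite rmorphM -mulmxA.
by rewrite rmorph1 mul1mx.
Qed.

(* The retraction of Hom_k(T, k) onto I_c averages over <g>.                  *)
Definition coind_retract (phi : T -> k) : 'cV[k]_p :=
  \col_j (p%:R^-1 * \sum_(i < p) (omega ^+ (i * c))^-1 * phi (e i j)).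

(** Linearity of the retraction for the action (a phi)(b) = phi(b a). On monomials, moving g^l
    through the average is a shift of a sum of period p. *)
Lemma coind_retract_act (phi : T -> k^o) a : linear phi ->
  coind_retract (fun b => phi (b * a)) = coind_act a (coind_retract phi).
Proof.
move=> lin_phi; have phi0 : phi 0 = 0.
  by have := lin_phi (-1) 0 0; rewrite scaler0 addr0 scaleN1r addNr.
have phiZ d y : phi (d *: y) = d * phi y.
  by have := lin_phi d y 0; rewrite phi0 !addr0.
move: a; apply: (taft_ind prim_omega p_neq0 taftT) => [d a b IHa IHb|l m lt_mp].
  rewrite (act_linearl module_action_coind) -IHa -IHb; apply/colP => j;
    rewrite !mxE.
  rewrite mulrCA -mulrDr; congr (_ * _); rewrite mulr_sumr -big_split;
    apply: eq_bigr => i _ /=.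
  by rewrite mulrDr -scalerAr lin_phi mulrDr mulrCA.
apply/colP => j; rewrite coind_actE !mxE.
have [lt_jmp|le_pjm] := ltnP (j + m) p; last first.
  rewrite coordn0 // mulr0 big1 ?mulr0 // => i _.
  by rewrite eM e0 // scaler0 phi0 mulr0.
rewrite coordn_lt mxE mulrCA; congr (_ * _).
pose F i := (omega ^+ (i * c))^-1 * phi (e i (j + m)).
rewrite /= -(periodic_sum (F := F) l) /F; last first.
  move=> i; rewrite mulnDl exprD eDp; congr (_^-1 * _).
  by rewrite (exprM omega p c) (prim_expr_order prim_omega) expr1n mulr1.
rewrite mulr_sumr; apply: eq_bigr => i _; rewrite eM phiZ mulrA mulrA.
congr (_ * _); have w0 n : omega ^+ n != 0 by rewrite expf_neq0 ?(omega_neq0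
  prim_omega).
apply: (mulIf (w0 ((i + l) * c)%N)); rewrite mulfVK //.
apply: (mulfI (w0 (i * c)%N)); rewrite !mulrA mulfV // mul1r -!exprD.
congr (_ ^+ _); lia.
Qed.

Lemma coind_retract_orbit v : coind_retract (fun b => coind_act b v 0 0) = v.
Proof.
apply/colP => j; rewrite mxE (eq_bigr (fun=> v j 0)) => [|i _]; last first.
  rewrite coind_actE /= addn0 add0n coordnE.
  by rewrite mulKf ?expf_neq0 ?(omega_neq0 prim_omega).
by rewrite sumr_const card_ord -[v j 0 *+ _]mulr_natl mulKf.
Qed.

Lemma eq_coind_retract (phi psi : T -> k) : phi =1 psi ->
  coind_retract phi = coind_retract psi.
Proof.
move=> eq_phi; apply/colP => j; rewrite !mxE; congr (_ * _).
by apply: eq_bigr => i _; rewrite eq_phi.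
Qed.

Lemma coind_retractDZ d (phi psi : T -> k) :
  coind_retract (fun b => d * phi b + psi b)
  = d *: coind_retract phi + coind_retract psi.
Proof.
apply/colP => j; rewrite !mxE mulrCA -mulrDr; congr (_ * _).
rewrite mulr_sumr -big_split; apply: eq_bigr => i _ /=.
by rewrite mulrDr mulrCA.
Qed.

Lemma coind_retractD (phi psi : T -> k) :
  coind_retract (fun b => phi b + psi b) = coind_retract phi + coind_retract
    psi.
Proof.
rewrite -[coind_retract phi]scale1r -coind_retractDZ.
by apply: eq_coind_retract => b; rewrite mul1r.
Qed.

Lemma coind_retract0 : coind_retract (fun=> 0) = 0.
Proof.
by apply/colP => j; rewrite !mxE big1 ?mulr0 // => i _; rewrite mulr0.
Qed.

Lemma coind_retractZ d (phi : T -> k) :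
  coind_retract (fun b => d * phi b) = d *: coind_retract phi.
Proof.
rewrite -[RHS]addr0 -coind_retract0 -coind_retractDZ.
by apply: eq_coind_retract => b; rewrite addr0.
Qed.

Lemma coind_retract_sum n (d : 'I_n -> k) (phi : 'I_n -> T -> k) :
  coind_retract (fun b => \sum_(i < n) d i * phi i b)
  = \sum_(i < n) d i *: coind_retract (phi i).
Proof.
elim: n d phi => [|n IH] d phi.
  by rewrite big_ord0 -coind_retract0; apply: eq_coind_retract => b;
    rewrite big_ord0.
rewrite big_ord_recl -IH -coind_retractDZ; apply: eq_coind_retract => b.
by rewrite big_ord_recl.
Qed.

(** I_c is a direct summand of Hom_k(T, k), whose cochains have the contracting homotopy that turns
    the first letter into the argument of the functional. The primitive is this homotopy followed by
    the retraction. *)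
Lemma coind_acyclic n f :
  ext_cocycle eps coind_act n.+1 f -> ext_coboundary eps coind_act n.+1 f.
Proof.
move=> [lin_f df0].
exists (fun w => coind_retract (fun b => f (b :: w) 0 0)).
  move=> s t szst c' u v; rewrite -coind_retractDZ.
  apply: eq_coind_retract => b; rewrite -!cat_cons lin_f ?mxE //= addSn szst //.
move=> w szw.
(* The cocycle identity at [b :: w], solved for its leading term and read in coordinate 0. *)
have act_f b : coind_act b (f w) 0 0
    = f (b * w`_0 :: behead w) 0 0
      + (\sum_(l < n) (-1) ^+ l.+1 * f (b :: take l w ++ w`_l * w`_l.+1 :: drop
        l.+2 w) 0 0
        + (-1) ^+ n.+1 * ((eps w`_n : k) * f (b :: take n w) 0 0)).
  have := df0 (b :: w); rewrite /= szw => /(_ erefl).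
  rewrite /bar_diff /= => /eqP; rewrite -addrA addr_eq0 => /eqP ->.
  rewrite big_ord_recl /= expr1 scaleN1r /=.
  rewrite !opprD opprK drop1 -addrA mxE; congr (_ + _); rewrite mxE;
    congr (_ + _).
    rewrite mxE summxE -sumrN; apply: eq_bigr => l _.
    by rewrite /bump leq0n add1n add0n mxE exprS mulN1r mulNr opprK.
  by rewrite !mxE exprS mulN1r mulNr opprK.
rewrite -[LHS]coind_retract_orbit (eq_coind_retract act_f).
pose A1 b := f (b * w`_0 :: behead w) 0 0.
pose A3 b := f (b :: take n w) 0 0.
pose A2 b := \sum_(l < n) (-1) ^+ l.+1 * f (b :: take l w ++ w`_l * w`_l.+1 ::
  drop l.+2 w) 0 0.
transitivity (coind_retract A1 + (coind_retract A2
    + ((-1) ^+ n.+1 * (eps w`_n : k)) *: coind_retract A3)).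
  rewrite -coind_retractZ -!coind_retractD; apply: eq_coind_retract => b.
  by rewrite /A1 /A2 /A3 mulrA.
rewrite /bar_diff -[RHS]addrA scalerA; congr (_ + (_ + _)).
  apply: (coind_retract_act (phi := fun b => f (b :: behead w) 0 0)) => d u v.
  by rewrite (lin_f [::] (behead w)) ?mxE // size_behead szw.
by rewrite -coind_retract_sum; apply: eq_coind_retract.
Qed.
End Coinduced.

Lemma eps_monomial l m : eps (e l m) = (m == 0%N)%:R.
Proof.
by rewrite rmorphM !rmorphXn /= eps_g eps_x expr1n mul1r expr0n.
Qed.

(** A 1-cocycle is a derivation at [eps]. From g^p = 1 it satisfies p D(g) = 0, and from x g = omega
    g x it satisfies D(x) = omega D(x) with omega distinct from 1, so it vanishes on the
    generators. *)
Lemma taft_ext1 f :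
  ext_cocycle eps (triv_act eps) 1 f -> ext_coboundary eps (triv_act eps) 1 f.
Proof.
move=> [lin_f df0]; pose D a : k := f [:: a].
have lin_D : linear (D : T -> k^o) by move=> d u v; exact: (lin_f [::] [::]).
have DM a b : D (a * b) = eps a * D b + eps b * D a.
  have := df0 [:: a; b] erefl.
  rewrite /bar_diff big_ord1 /= expr1 scaleN1r sqrrN expr1n scale1r addrAC.
  by move/eqP; rewrite subr_eq0 eq_sym => /eqP.
have DZ d a : D (d *: a) = d * D a.
  have D0 : D 0 = 0 by have := lin_D (-1) 0 0;
    rewrite scaler0 addr0 scaleN1r addNr.
  by have := lin_D d a 0; rewrite D0 !addr0.
have D1 : D 1 = 0.
  have := DM 1 1; rewrite mulr1 rmorph1 !mul1r => /eqP.
  by rewrite -subr_eq subrr eq_sym => /eqP.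
have Dg n : D (g ^+ n) = n%:R * D g.
  elim: n => [|n IH]; first by rewrite expr0 D1 mul0r.
  by rewrite exprS DM IH rmorphXn /= eps_g expr1n !mul1r [in RHS]mulrSr mulrDl
    mul1r.
have [[gp _ xg] _] := taftT.
have Dg0 : D g = 0.
  by have /eqP := Dg p; rewrite gp D1 eq_sym mulf_eq0 (negPf p_neq0) => /eqP.
have Dx0 : D x = 0.
  have := congr1 D xg; rewrite DZ !DM eps_g eps_x Dg0 !mul1r !mulr0 addr0 add0r.
  move/eqP; rewrite -subr_eq0 -{1}[D x]mul1r -mulrBl mulf_eq0 subr_eq0 =>
    /orP[|/eqP //].
  rewrite eq_sym -(expr0 omega) -{1}(expr1 omega) (eq_prim_root_expr
    prim_omega).
  by rewrite mod0n modn_small.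
have Dxj j : D (x ^+ j) = 0.
  by elim: j => [|j IH]; rewrite ?expr0 ?D1 // exprS DM IH Dx0 !mulr0 addr0.
have D0 : forall a, D a = 0.
  apply: (taft_ind prim_omega p_neq0 taftT) => [d a b IHa IHb|i j _].
    by rewrite [LHS]lin_D IHa IHb scaler0 addr0.
  by rewrite DM Dg Dg0 Dxj !mulr0 addr0.
exists (fun=> 0); first exact: multilinear_const0.
move=> [|a []] // _; rewrite (bar_diff0 (bimodule_act eps (module_action_triv
  eps))).
exact: D0.
Qed.

Lemma taft_ext_odd n f : odd n ->
  ext_cocycle eps (triv_act eps) n f -> ext_coboundary eps (triv_act eps) n f.
Proof.
have [rho0 [rho0g rho0x]] := taft_representation prim_omega taftT 0.
have [rho1 [rho1g rho1x]] := taft_representation prim_omega taftT 1.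
(* The sequence k -> I_0 -> I_1 -> k: coordinate 0 of I_0 is the trivial submodule, and [u] is the
   shift by x, linear because coordinate j + 1 of I_0 and coordinate j of I_1 have the same weight.
   The cokernel is the last coordinate, trivial since its weight is omega^(1+q) = 1. *)
pose iota (m : k^o) : 'cV[k]_p := \col_j ((j == 0 :> nat)%:R * m).
pose sigma (m : k^o) : 'cV[k]_p := \col_j ((j == q :> nat)%:R * m).
pose rho (v : 'cV[k]_p) : k^o := v 0 0.
pose pi (v : 'cV[k]_p) : k^o := v ord_max 0.
pose u (v : 'cV[k]_p) : 'cV[k]_p := taft_x k q *m v.
pose v (z : 'cV[k]_p) : 'cV[k]_p := \col_j (if nat_of_ord j is j'.+1 then
  coordn z j' else 0).
have lin_iota : linear iota by move=> d a b; apply/colP => j;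
  rewrite !mxE mulrDr mulrCA.
have lin_sigma : linear sigma by move=> d a b; apply/colP => j;
  rewrite !mxE mulrDr mulrCA.
have lin_rho : linear rho by move=> d a b; rewrite /rho !mxE.
have lin_pi : linear pi by move=> d a b; rewrite /pi !mxE.
have lin_u : linear u by move=> d a b; rewrite /u mulmxDr -scalemxAr.
have lin_v : linear v.
  move=> d a b; apply/colP => j; rewrite !mxE.
  case: j => [[|j] lt_j] /=; first by rewrite mulr0 addr0.
  by rewrite !(coordn_lt _ (ltnW lt_j)) !mxE.
have e_actE (rhoc : {lrmorphism T -> 'M[k]_p}) c : rhoc g = taft_g q omega c ->
    rhoc x = taft_x k q -> forall l m z i, coind_act rhoc (e l m) z i 0
    = omega ^+ (l * (c + i)) * coordn z (i + m).
  by move=> *; apply: coind_actE.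
have act_ind (M N : lmodType k) (actM : T -> M -> M) (actN : T -> N
  -> N) (phi : M -> N) :
    linear phi -> (forall m, linear (actM^~ m))
      -> (forall m, linear (actN^~ m)) ->
    (forall l j m, phi (actM (e l j) m) = actN (e l j) (phi m)) ->
    forall a m, phi (actM a m) = actN a (phi m).
  move=> lin_phi lin_actM lin_actN phi_e a m; move: a.
  apply: (taft_ind prim_omega p_neq0 taftT) => [d a b IHa IHb|l j _];
    last exact: phi_e.
  by rewrite lin_actM lin_phi IHa IHb lin_actN.
have coordn_iota m j : coordn (iota m) j = (j == 0%N)%:R * m.
  have [lt_jp|le_pj] := ltnP j p; first by rewrite coordn_lt mxE.
  by rewrite coordn0 // gtn_eqF ?mul0r // (leq_trans _ le_pj).
have coordn_u z j : coordn (u z) j = coordn z j.+1.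
  have [lt_jp|le_pj] := ltnP j p; first by rewrite coordn_lt taft_x_mul.
  by rewrite !coordn0 // leqW.
have lin_triv := act_linearl (module_action_triv eps).
have lin_act0 := act_linearl (module_action_coind rho0).
have lin_act1 := act_linearl (module_action_coind rho1).
have iota_act : forall a m, iota (triv_act eps a m) = coind_act rho0 a (iota m).
  apply: act_ind => // l j m; apply/colP => i.
  rewrite (e_actE _ _ rho0g rho0x) mxE /triv_act eps_monomial coordn_iota
    addn_eq0.
  case: (i == 0 :> nat) / eqP => [->|_]; last by rewrite !mul0r mulr0.
  by rewrite muln0 expr0 !mul1r.
have u_act : forall a z, u (coind_act rho0 a z) = coind_act rho1 a (u z).
  apply: act_ind => // l j z; apply/colP => i.
  rewrite (e_actE _ _ rho1g rho1x) taft_x_mul coordn_u.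
  have [lt_ip|le_pi] := ltnP i.+1 p; last first.
    by rewrite !coordn0 ?mulr0 // (leq_trans le_pi) // ltnS leq_addr.
  by rewrite coordn_lt (e_actE _ _ rho0g rho0x) add0n add1n addSn.
have pi_act : forall a z, pi (coind_act rho1 a z) = triv_act eps a (pi z).
  apply: act_ind => // l j z.
  rewrite /pi (e_actE _ _ rho1g rho1x) /triv_act eps_monomial /= add1n.
  rewrite mulnC exprM (prim_expr_order prim_omega) expr1n mul1r.
  case: j => [|j]; first by rewrite addn0 -[q]/(ord_max : nat) coordnE mul1r.
  by rewrite coordn0 ?mul0r // addnS ltnS leq_addr.
have iotaK : cancel iota rho by move=> m; rewrite /rho mxE mul1r.
have u_iota m : u (iota m) = 0.
  by apply/colP => i; rewrite taft_x_mul coordn_iota mxE mul0r.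
have ker_u z : u z = 0 -> z = iota (rho z).
  move=> /colP uz0; apply/colP => -[[|j] lt_j];
    rewrite mxE /= ?mul1r ?mul0r /rho.
    by congr (z _ _); apply: val_inj.
  by have := uz0 (Ordinal (ltnW lt_j)); rewrite taft_x_mul mxE /= (coordn_lt _
    lt_j).
have pi_u z : pi (u z) = 0 by rewrite /pi taft_x_mul coordn0.
have ker_pi z : pi z = 0 -> z = u (v z).
  move=> pz0; apply/colP => j; rewrite taft_x_mul.
  have [lt_jp|le_pj] := ltnP j.+1 p; first by rewrite coordn_lt mxE /= coordnE.
  rewrite coordn0 // -[RHS]pz0 /pi; congr (z _ _); apply: val_inj => /=.
  by apply/eqP; rewrite eqn_leq -ltnS ltn_ord.
have sigmaK : cancel sigma pi by move=> m; rewrite /pi mxE eqxx mul1r.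
(* Degree 1 is the base case; degree n + 3 is reduced to degree n + 1 with the same trivial
   coefficients. *)
elim/ltn_ind: n f => -[|[|[|n]]] IH f //= odd_n; first exact: taft_ext1.
rewrite negbK in odd_n.
apply: (@ext_dimension_shift _ _ _ _ _ _ _ _ _ _ _
  (module_action_coind rho0) (module_action_coind rho1)
  (linear_pack lin_iota) (linear_pack lin_u) (linear_pack lin_pi)
  (linear_pack lin_rho) (linear_pack lin_v) (linear_pack lin_sigma)) => //.
- by move=> f'; apply: (coind_acyclic rho0g rho0x).
- by move=> f'; apply: (coind_acyclic rho1g rho1x).
by move=> f'; apply: IH.
Qed.
End TaftVanishing.

Theorem mainTheorem1 (p : nat) (k : fieldType) (omega : k)
    (T : algType k) (g x : T)
    (delta : T -> seq (T * T)) (eps : {lrmorphism T -> k^o})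
    (S : {linear T -> T}) :
  (2 < p)%N -> [pchar k] =i pred0 -> p.-primitive_root omega ->
  is_taft_algebra p omega g x -> is_taft_hopf p g x delta eps S ->
  (exists (m n : nat) (f h : seq T -> T),
     [/\ HH_cocycle m f, HH_cocycle n h &
         ~ HH_coboundary (m + n).-1 (gbracket m n f h)]) /\
  (forall (m n : nat) (alpha beta : seq T -> k^o),
     ext_cocycle eps (triv_act eps) m alpha ->
     ext_cocycle eps (triv_act eps) n beta ->
     (exists gamma : seq T -> k^o,
        is_hopf_bracket delta eps S m n alpha beta gamma) /\
     (forall gamma : seq T -> k^o,
        is_hopf_bracket delta eps S m n alpha beta gamma ->
        ext_coboundary eps (triv_act eps) (m + n).-1 gamma)).
Proof.
move=> p_gt2 char0 prim_omega taftT [hopfT _ [eps_g eps_x] _].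
have p_neq0 : p%:R != 0 :> k by rewrite ((pcharf0P k).1 char0) -lt0n; lia.
case: p p_gt2 prim_omega taftT p_neq0 => // q q_gt1 prim_omega taftT p_neq0.
have q_gt0 : (0 < q)%N by apply: ltnW.
split.
  exact: (taft_HH_bracket_nonzero q_gt0 prim_omega p_neq0 taftT eps_x).
apply: (hopf_bracket_odd_vanishing hopfT) => n alpha.
exact: (taft_ext_odd q_gt0 prim_omega p_neq0 taftT eps_g eps_x).
Qed.
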